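(* Let $W=(W_1,\ldots,W_n)$ be a weighted left multi-shift associated with the weight sequence $\boldsymbol\mu=\{\mu_\beta\}_{|\beta|\ge1}$. Then the following statements are equivalent. (i) $W$ is a row power bounded $n$-tuple of operators, i.e. there is a constant $C>0$ such that $\big\|\sum_{|\alpha|=k}W_\alpha W_\alpha^*\big\|^{1/2}\le C$ for all $k\in\mathbb N$. (ii) There exists $M>0$ such that $\sup_{\alpha,\beta\in\mathbb F_n^+,\,|\beta|=k}\boldsymbol\mu(\beta,\alpha)\le M$ for any $k\in\mathbb N$. (iii) $W$ is jointly similar to a row contraction. (iv) $W$ is jointly similar to a pure row contraction. (v) $W$ is completely polynomially bounded with respect to the left creation operators $S_1,\ldots,S_n$, i.e. there is $C>0$ such that $\|[p_{s,q}(W_1,\ldots,W_n)]_{k\times k}\|\le C\|[p_{s,q}(S_1,\ldots,S_n)]_{k\times k}\|$ for all $k\in\mathbb N$ and all $k\times k$ matrices of noncommutative polynomials $p_{s,q}\in\mathbb C\langle Z_1,\ldots,Z_n\rangle$. (vi) $W$ is polynomially bounded with respect to the left creation operators, i.e. there is $C>0$ such that $\|p(W_1,\ldots,W_n)\|\le C\|p(S_1,\ldots,S_n)\|$ for all $p\in\mathbb C\langle Z_1,\ldots,Z_n\rangle$. In this case, the operator $A$ implementing the similarity can be chosen such that $\|A\|\,\|A^{-1}\|\le M$, where $M>0$ is the constant in (ii).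
   Context: Let $n\ge 1$ and let $\mathbb F_n^+$ be the unital free semigroup on generators $g_1,\ldots,g_n$ with identity $g_0$; $|\alpha|$ is the length of $\alpha$. $F^2(H_n)$ is the full Fock space, a Hilbert space with orthonormal basis $\{e_\alpha\}_{\alpha\in\mathbb F_n^+}$; the left creation operators are $S_ie_\alpha=e_{g_i\alpha}$. For operators $T_1,\ldots,T_n$, $T_\alpha:=T_{i_1}\cdots T_{i_k}$ if $\alpha=g_{i_1}\cdots g_{i_k}$ and $T_{g_0}:=I$. The weighted left multi-shift associated with weights $\mu_\beta\ge0$ ($|\beta|\ge1$) satisfying $\sup_{\alpha}\mu_{g_i\alpha}<\infty$ for each $i$ is $W=(W_1,\ldots,W_n)$ with $W_ie_\alpha=\mu_{g_i\alpha}e_{g_i\alpha}$. For $\alpha,\beta\in\mathbb F_n^+$, $\boldsymbol\mu(\beta,\alpha):=\mu_{g_{i_1}\cdots g_{i_p}\alpha}\,\mu_{g_{i_2}\cdots g_{i_p}\alpha}\cdots\mu_{g_{i_p}\alpha}$ if $\beta=g_{i_1}\cdots g_{i_p}$, and $\boldsymbol\mu(g_0,\alpha):=1$. $T=(T_1,\ldots,T_n)\in B(\mathcal H)^n$ is a row contraction if $T_1T_1^*+\cdots+T_nT_n^*\le I$; it is pure if $\sum_{|\alpha|=k}T_\alpha T_\alpha^*\to0$ in the strong operator topology as $k\to\infty$. $T\in B(\mathcal H)^n$ is jointly similar to $T'\in B(\mathcal K)^n$ if there is an invertible operator $A:\mathcal H\to\mathcal K$ with $T_i=A^{-1}T_i'A$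 for all $i$; $A$ is said to implement the similarity. *)

(* Defs.v *)
From HB Require Import structures.
From mathcomp Require Import all_boot all_order all_algebra.
From mathcomp Require Import all_classical all_reals all_analysis.
From mathcomp Require Import complex finmap.
(* The notations of monalg clash with those of mathcomp-analysis. *)
From mathcomp Require Import -(notations) monalg.

Set Implicit Arguments.
Unset Strict Implicit.
Unset Printing Implicit Defensive.

Import Order.TTheory GRing.Theory Num.Theory numFieldNormedType.Exports.

Local Open Scope classical_set_scope.
Local Open Scope ring_scope.
Local Open Scope complex_scope.

(* The inner product is linear in its first argument and conjugate-linear in
   the second one; the norm of the underlying complex Banach space is the one
   it induces.  The norm takes its (real, nonnegative) values in R[i]. *)
HB.mixin Record CompleteNormedModule_isHilbert (R : realType) H
    of CompleteNormedModule R[i] H := {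
  inner : {dot H for @Num.conj R[i]};
  inner_norm : forall x : H, `|x| ^+ 2 = inner x x
}.

#[short(type="hilbertType")]
HB.structure Definition Hilbert (R : realType) :=
  {H of CompleteNormedModule R[i] H & CompleteNormedModule_isHilbert R H}.

Arguments inner {R s}.

Section Operators.
Context {R : realType}.
Implicit Types H K : hilbertType R.

Record bop H K := Bop {
  bop_fun :> {linear H -> K};
  bop_continuous : continuous bop_fun
}.

Definition hnorm H (x : H) : R := complex.Re `|x|.

Definition opnorm H K (T : H -> K) : R :=
  sup [set hnorm (T x) | x in [set x : H | hnorm x <= 1]].

(* Norm of the k x k operator matrix [T s q] acting on the Hilbert space direct
   sum of k copies of H. *)
Definition opmx_norm H k (T : 'I_k -> 'I_k -> H -> H) : R :=
  sup [set Num.sqrt (\sum_(s < k) hnorm (\sum_(q < k) T s q (x q)) ^+ 2)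
      | x in [set x : 'I_k -> H | \sum_(q < k) hnorm (x q) ^+ 2 <= 1]].

(* T^* y is the unique z such that <T x, y> = <x, z> for every x; it exists by
   the Riesz representation theorem when T is a bounded operator, and the
   default value 0 is then never used. *)
Definition adjoint H K (T : H -> K) (y : K) : H :=
  xget 0 [set z : H | forall x, inner (T x) y = inner x z].

Definition orthonormal_basis H (I : eqType) (e : I -> H) : Prop :=
  (forall a b, inner (e a) (e b) = (a == b)%:R) /\
  dense [set x : H | exists (s : seq I) (c : I -> R[i]),
                       x = \sum_(a <- s) c a *: e a].

Section Tuples.
Context {n : nat}.

(* The free semigroup on n generators is seq 'I_n: g_0 is [::] and the word
   g_{i_1} ... g_{i_k} is [:: i_1; ...; i_k]. *)
Definition opword H (T : 'I_n -> bop H H) (a : seq 'I_n) : H -> H :=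
  fun x => foldr (fun i y => T i y) x a.

Definition word_sum H (T : 'I_n -> bop H H) (k : nat) : H -> H :=
  fun x => \sum_(a : k.-tuple 'I_n) opword T a (adjoint (opword T a) x).

Definition row_contraction H (T : 'I_n -> bop H H) : Prop :=
  forall x, inner (\sum_(i < n) T i (adjoint (T i) x)) x <= inner x x.

Definition pure H (T : 'I_n -> bop H H) : Prop :=
  forall x, (fun k => word_sum T k x) @ \oo --> (0 : H).

Definition row_power_bounded H (T : 'I_n -> bop H H) : Prop :=
  exists2 C : R, 0 < C & forall k, Num.sqrt (opnorm (word_sum T k)) <= C.

Definition implements_similarity H K (T : 'I_n -> bop H H)
    (T' : 'I_n -> bop K K) (A : bop H K) (B : bop K H) : Prop :=
  [/\ cancel A B, cancel B A & forall i x, T i x = B (T' i (A x))].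

Definition jointly_similar H K (T : 'I_n -> bop H H)
    (T' : 'I_n -> bop K K) : Prop :=
  exists (A : bop H K) (B : bop K H), implements_similarity T T' A B.

(* Noncommutative polynomials: the complex algebra of the free monoid. *)
Definition ncpoly : Type := malg (fmonom 'I_n) R[i].

Definition nceval H (T : 'I_n -> bop H H) (p : ncpoly) : H -> H :=
  fun x => \sum_(m <- msupp p) mcoeff m p *: opword T m x.

Definition completely_polynomially_bounded H (T S : 'I_n -> bop H H) : Prop :=
  exists2 C : R, 0 < C & forall k (p : 'I_k -> 'I_k -> ncpoly),
    opmx_norm (fun s q => nceval T (p s q)) <=
    C * opmx_norm (fun s q => nceval S (p s q)).

Definition polynomially_bounded H (T S : 'I_n -> bop H H) : Prop :=
  exists2 C : R, 0 < C &
    forall p : ncpoly, opnorm (nceval T p) <= C * opnorm (nceval S p).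

(* The full Fock space is given by its orthonormal basis e, indexed by words. *)
Definition left_creation H (e : seq 'I_n -> H) (S : 'I_n -> bop H H) : Prop :=
  forall i a, S i (e a) = e (i :: a).

(* Only the values of mu at nonempty words matter. *)
Definition multishift_weights (mu : seq 'I_n -> R) : Prop :=
  (forall b, b != [::] -> 0 <= mu b) /\
  (forall i, has_ubound [set mu (i :: a) | a in setT]).

Definition weighted_multishift H (e : seq 'I_n -> H) (mu : seq 'I_n -> R)
    (W : 'I_n -> bop H H) : Prop :=
  forall i a, W i (e a) = (mu (i :: a))%:C *: e (i :: a).

Fixpoint weight_prod (mu : seq 'I_n -> R) (b a : seq 'I_n) : R :=
  if b is _ :: b' then mu (b ++ a) * weight_prod mu b' a else 1.

Definition weight_bound (mu : seq 'I_n -> R) (M : R) : Prop :=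
  forall k : nat,
    (ereal_sup [set (weight_prod mu ab.2 ab.1)%:E
               | ab in [set ab : seq 'I_n * seq 'I_n | size ab.2 = k]]
     <= M%:E)%E.

End Tuples.
End Operators.

Arguments ncpoly : clear implicits.

(* Main.v *)
(** Write [d a] for the supremum over [b] of the weight products [mu(b, a)].  Under
    (ii) it lies in [[1, M]] and [d (i a) * mu (i a) <= d a], so conjugating [W]
    by the diagonal operator [d] gives a multishift [T] with weights [nu <= 1].
    The ranges of the [T_a] with [|a|] fixed are mutually orthogonal, hence [T] is
    a row contraction; as [T_a^* e_b = 0] for [|a| > |b|], it is pure.

    For (v), [p(W)] is the Schur product of [p(S)] with the matrix whose entry at
    [(b a, a)] is [mu(b, a) = d a / d (b a) * <xi_(b a), xi_a>] for suitable unit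
    vectors [xi_a] of l^2.  Coordinatewise this reads
    [p(W) = sum_j D'_j p(S) D_j] with diagonal operators [D_j = d xi(j)] and
    [D'_j = xi(j) / d] satisfying [sum_j D_j^2 <= M^2] and [sum_j D'_j^2 <= 1],
    whence [||p(W)|| <= M ||p(S)||], also for matrices of polynomials.

    Conversely each of (i), (iii) and (vi) bounds [||W_b||] uniformly in [b], and
    [mu(b, a) = ||W_b e_a||]; (ii) gives (i) by orthogonality of ranges again. *)

From HB Require Import structures.
Require Import Defs.
From mathcomp Require Import all_boot all_order all_algebra.
From mathcomp Require Import all_classical all_reals all_analysis.
From mathcomp Require Import complex finmap ring lra.
(* The notations of monalg clash with those of mathcomp-analysis. *)
From mathcomp Require Import -(notations) monalg.

Set Implicit Arguments.
Unset Strict Implicit.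
Unset Printing Implicit Defensive.
Import Order.TTheory GRing.Theory Num.Theory numFieldNormedType.Exports.
Local Open Scope classical_set_scope.
Local Open Scope ring_scope.

(** * Inner products and the induced norm *)

Section Inner.
Context {R : realType} {H : hilbertType R}.
Implicit Types (x y z : H) (c : R[i]).

Lemma normE x : `|x| = (hnorm x)%:C%C.
Proof. by rewrite /hnorm RRe_real// normr_real. Qed.

Lemma hnorm_ge0 x : 0 <= hnorm x.
Proof. by rewrite -lecR -normE; exact: normr_ge0. Qed.

Lemma hnorm0 : hnorm (0 : H) = 0.
Proof. by rewrite /hnorm normr0. Qed.

Lemma hnorm_eq0 x : hnorm x = 0 -> x = 0.
Proof. by move=> h; apply/eqP; rewrite -normr_eq0 normE h. Qed.

Lemma hnorm_triangle x y : hnorm (x + y) <= hnorm x + hnorm y.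
Proof. by rewrite -lecR rmorphD/= -!normE ler_normD. Qed.

Lemma hnorm_oppr x : hnorm (- x) = hnorm x.
Proof. by rewrite /hnorm normrN. Qed.

Lemma hnorm_distC x y : hnorm (x - y) = hnorm (y - x).
Proof. by rewrite /hnorm distrC. Qed.

Definition cnorm c : R := complex.Re `|c|.

Lemma cnormE c : `|c| = (cnorm c)%:C%C.
Proof. by rewrite /cnorm RRe_real// normr_real. Qed.

Lemma cnorm_ge0 c : 0 <= cnorm c.
Proof. by rewrite -lecR -cnormE; exact: normr_ge0. Qed.

Lemma hnormZ c x : hnorm (c *: x) = cnorm c * hnorm x.
Proof. by apply: complexI; rewrite rmorphM/= -normE -cnormE -normE normrZ. Qed.

Lemma hnormZR (r : R) x : hnorm (r%:C%C *: x) = `|r| * hnorm x.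
Proof.
rewrite hnormZ; congr (_ * _); apply: complexI; rewrite -cnormE.
by rewrite normc_def/= expr0n addr0 sqrtr_sqr.
Qed.

Lemma innerDl x y z : inner (x + y) z = inner x z + inner y z.
Proof. exact: linearDl. Qed.
Lemma innerDr x y z : inner x (y + z) = inner x y + inner x z.
Proof. exact: linearDr. Qed.
Lemma innerZl c x y : inner (c *: x) y = c * inner x y.
Proof. exact: linearZl_LR. Qed.
Lemma innerZr c x y : inner x (c *: y) = Num.conj c * inner x y.
Proof. exact: linearZr_LR. Qed.
Lemma innerC x y : inner x y = Num.conj (inner y x).
Proof. by have := hermC (inner : {dot H for Num.conj}) x y; rewrite expr0 mul1r. Qed.
Lemma inner_suml I (r : seq I) (E : I -> H) y :
  inner (\sum_(i <- r) E i) y = \sum_(i <- r) inner (E i) y.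
Proof. exact: linear_sumlz. Qed.
Lemma inner_sumr I (r : seq I) (E : I -> H) y :
  inner y (\sum_(i <- r) E i) = \sum_(i <- r) inner y (E i).
Proof. exact: linear_sumr. Qed.
Lemma inner0l y : inner 0 y = 0.
Proof. exact: linear0l. Qed.
Lemma inner0r y : inner y 0 = 0.
Proof. exact: linear0r. Qed.
Lemma innerNr x y : inner x (- y) = - inner x y.
Proof. exact: linearNr. Qed.

Definition rinner x y : R := complex.Re (inner x y).

Lemma innerE x : inner x x = (hnorm x ^+ 2)%:C%C.
Proof. by rewrite -inner_norm normE rmorphXn. Qed.

Lemma rinnerE x : rinner x x = hnorm x ^+ 2.
Proof. by rewrite /rinner innerE. Qed.
Lemma rinnerDl x y z : rinner (x + y) z = rinner x z + rinner y z.
Proof. by rewrite /rinner innerDl raddfD. Qed.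
Lemma rinnerDr x y z : rinner x (y + z) = rinner x y + rinner x z.
Proof. by rewrite /rinner innerDr raddfD. Qed.
Lemma rinnerNr x y : rinner x (- y) = - rinner x y.
Proof. by rewrite /rinner innerNr raddfN. Qed.
Lemma rinnerC x y : rinner x y = rinner y x.
Proof. by rewrite /rinner innerC; case: (inner y x). Qed.
Lemma rinnerZl (r : R) x y : rinner (r%:C%C *: x) y = r * rinner x y.
Proof. by rewrite /rinner innerZl; case: (inner x y) => a b /=; ring. Qed.
Lemma rinnerZr (r : R) x y : rinner x (r%:C%C *: y) = r * rinner x y.
Proof. by rewrite rinnerC rinnerZl rinnerC. Qed.

Lemma hnorm_sqD x y :
  hnorm (x + y) ^+ 2 = hnorm x ^+ 2 + hnorm y ^+ 2 + 2 * rinner x y.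
Proof.
by rewrite -!rinnerE rinnerDl !rinnerDr (rinnerC y x); ring.
Qed.

Lemma hnorm_sqB x y :
  hnorm (x - y) ^+ 2 = hnorm x ^+ 2 + hnorm y ^+ 2 - 2 * rinner x y.
Proof. by rewrite hnorm_sqD hnorm_oppr rinnerNr; ring. Qed.

(** Cauchy-Schwarz for the real part: expand the square of the norm of [||y|| x - ||x|| y] and
    divide by [||x|| ||y||]; the two degenerate cases are treated apart. *)
Lemma rinner_le x y : rinner x y <= hnorm x * hnorm y.
Proof.
have [y0|y0] := eqVneq (hnorm y) 0.
  by rewrite (hnorm_eq0 y0) /rinner inner0r hnorm0 mulr0.
have := sqr_ge0 (hnorm ((hnorm y)%:C%C *: x - (hnorm x)%:C%C *: y)).
rewrite hnorm_sqB !hnormZR rinnerZl rinnerZr !ger0_norm ?hnorm_ge0//.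
have [x0|x0] := eqVneq (hnorm x) 0.
  by rewrite (hnorm_eq0 x0) /rinner inner0l hnorm0 mul0r.
have xp : 0 < hnorm x by rewrite lt_neqAle eq_sym x0 hnorm_ge0.
have yp : 0 < hnorm y by rewrite lt_neqAle eq_sym y0 hnorm_ge0.
have xyp := mulr_gt0 xp yp.
move=> h; rewrite -(ler_pM2l xyp); nra.
Qed.

Lemma cnorm_inner x y : cnorm (inner x y) <= hnorm x * hnorm y.
Proof.
set a := inner x y.
have [a0|a0] := eqVneq a 0.
  by rewrite a0 /cnorm normr0 mulr_ge0 ?hnorm_ge0.
(* Multiplying by this phase turns [inner x y] into its modulus, which reduces the complex
   inequality to [rinner_le]. *)
pose u := `|a| / a.
have -> : cnorm a = rinner (u *: x) y.
  by rewrite /rinner innerZl -/a divfK.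
apply: le_trans (rinner_le _ _) _.
rewrite hnormZ /cnorm normrM normfV normr_id divff ?normr_eq0//=.
by rewrite mul1r.
Qed.

Lemma hnorm_le_test x (c : R) :
  0 <= c -> (forall y, rinner x y <= c * hnorm y) -> hnorm x <= c.
Proof.
move=> c0 /(_ x); rewrite rinnerE expr2.
have [x0|x0] := eqVneq (hnorm x) 0; first by rewrite x0.
by rewrite ler_pM2r // lt_neqAle eq_sym x0 hnorm_ge0.
Qed.

Lemma inner_ext x x' : (forall y, inner y x = inner y x') -> x = x'.
Proof.
move=> h; apply/eqP; rewrite -subr_eq0; apply/eqP/hnorm_eq0/eqP.
by rewrite -sqrf_eq0 -rinnerE /rinner innerDr innerNr h subrr.
Qed.

Lemma hnorm_sum I (r : seq I) (E : I -> H) :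
  hnorm (\sum_(i <- r) E i) <= \sum_(i <- r) hnorm (E i).
Proof.
elim/big_rec2: _ => [|i y1 y2 _ h]; first by rewrite hnorm0.
by apply: le_trans (hnorm_triangle _ _) _; rewrite lerD2l.
Qed.

(** The topology of [H] comes from an [R[i]]-valued norm; this moves convergence questions to [R],
    whose order is total. *)
Lemma cvg_hnormP (u : nat -> H) (l : H) :
  u @ \oo --> l <-> (fun k => hnorm (u k - l)) @ \oo --> (0 : R).
Proof.
split.
  move=> /cvgrPdist_lt h; apply/cvgrPdist_lt => eps e0.
  have e0' : 0 < eps%:C%C :> R[i] by rewrite ltcR.
  have := h _ e0'; apply: filterS => k /=.
  by rewrite normE ltcR hnorm_distC sub0r normrN ger0_norm ?hnorm_ge0.
move=> /cvgrPdist_lt h; apply/cvgrPdist_lt => eps e0.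
have -> : eps = (complex.Re eps)%:C%C by rewrite RRe_real ?gtr0_real.
have e0' : 0 < complex.Re eps by rewrite -ltcR RRe_real ?gtr0_real.
have := h _ e0'; apply: filterS => k /=.
by rewrite normE ltcR hnorm_distC sub0r normrN ger0_norm ?hnorm_ge0.
Qed.

Lemma cvg_hnorm (u : nat -> H) (l : H) :
  u @ \oo --> l -> (fun k => hnorm (u k)) @ \oo --> hnorm l.
Proof.
move=> /cvg_hnormP h; apply/cvgrPdist_lt => eps e0.
move/cvgrPdist_lt: h => /(_ _ e0); apply: filterS => k /=.
rewrite sub0r normrN ger0_norm ?hnorm_ge0//; apply: le_lt_trans.
have h1 := hnorm_triangle (u k - l) l; have h2 := hnorm_triangle (l - u k) (u k).
rewrite !subrK in h1 h2; rewrite hnorm_distC in h2.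
by rewrite ler_norml; apply/andP; split; lra.
Qed.

Lemma hnorm_cauchy_cvg (u : nat -> H) :
  (forall eps : R, 0 < eps -> exists N, forall k m, (N <= k)%N -> (N <= m)%N ->
     hnorm (u k - u m) < eps) -> cvgn u.
Proof.
move=> h; apply/cauchy_cvgP/cauchy_ballP => eps e0.
have e0' : 0 < complex.Re eps by rewrite -ltcR RRe_real ?gtr0_real.
have [N hN] := h _ e0'.
exists ([set u k | k in [set k | (N <= k)%N]], [set u k | k in [set k | (N <= k)%N]]).
  by split; exists N => // k /= Nk; exists k.
move=> [x y] [/= [k Nk <-] [m Nm <-]].
by rewrite -ball_normE /ball_/= normE -[eps]RRe_real ?gtr0_real// ltcR hN.
Qed.

End Inner.
Arguments cnorm {R}.

(** * Bounded linear maps, Riesz representation and adjoints *)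

Section Riesz.
Context {R : realType} {H : hilbertType R}.

(** Variational proof: the representing vector is the minimiser of [||x||^2 - 2 Re (f x)].
    Completeness provides it, and the imaginary part follows from the real one. *)
Lemma riesz (f : H -> R[i]) (C : R) :
  (forall a u v, f (a *: u + v) = a * f u + f v) ->
  (forall x, cnorm (f x) <= C * hnorm x) ->
  exists z, forall x, f x = inner x z.
Proof.
move=> flin fbd.
have f0 : f 0 = 0.
  by have := flin (-1) 0 0; rewrite scaler0 addr0 mulN1r addNr.
have fD u v : f (u + v) = f u + f v by have := flin 1 u v; rewrite scale1r mul1r.
have fZ a u : f (a *: u) = a * f u by have := flin a u 0; rewrite !addr0 f0 addr0.
have fB u v : f (u - v) = f u - f v by rewrite fD -scaleN1r fZ mulN1r.
pose r x : R := complex.Re (f x).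
have rD u v : r (u + v) = r u + r v by rewrite /r fD raddfD.
have rB u v : r (u - v) = r u - r v by rewrite /r fB raddfB.
have rZ (t : R) u : r (t%:C%C *: u) = t * r u.
  by rewrite /r fZ; case: (f u) => a b /=; ring.
have rbd x : r x <= C * hnorm x.
  apply: le_trans (fbd x); rewrite /cnorm normc_def/= /r.
  apply: le_trans (ler_norm _) _; rewrite -sqrtr_sqr.
  by rewrite ler_sqrt ?addr_ge0 ?sqr_ge0// lerDl sqr_ge0.
have rbd' x : `|r x| <= C * hnorm x.
  rewrite ler_norml rbd andbT lerNl -[- r x]mulN1r -rZ.
  by apply: le_trans (rbd _) _; rewrite hnormZR normrN1 mul1r.
(* If [r] is represented by [z], then [g x = ||x - z||^2 - ||z||^2], whose only minimiser is [z]. *)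
pose g x := hnorm x ^+ 2 - 2 * r x.
have glb x : - (C ^+ 2) <= g x.
  rewrite /g; have := rbd x; have := sqr_ge0 (hnorm x - C); nra.
pose m := inf (range g).
have hi : has_inf (range g).
  by split; [exists (g 0), 0|exists (- (C ^+ 2)) => _ [x _ <-]].
have mle x : m <= g x by apply: ge_inf; [exact: hi.2|exists x].
(* Parallelogram law, combined with [m <= g] at the midpoint of [x] and [y]; it makes minimising
   sequences Cauchy. *)
have par x y : hnorm (x - y) ^+ 2 <= 2 * (g x - m) + 2 * (g y - m).
  have := mle ((2^-1)%:C%C *: (x + y)).
  rewrite /g rZ rD hnormZR hnorm_sqB.
  have := hnorm_sqD x y; rewrite exprMn real_normK ?num_real// => ->.
  lra.
have [u hu] : {u : nat -> H & forall k, g (u k) < m + k.+1%:R^-1}.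
  apply: (@boolp.choice _ _ (fun k x => g x < m + k.+1%:R^-1)) => k.
  have k0 : 0 < (k.+1%:R^-1 : R) by rewrite invr_gt0.
  have [_ [x _ <-] hx] := inf_adherent k0 hi; by exists x.
have uc : cvgn u.
  apply: hnorm_cauchy_cvg => eps e0.
  have e2 : 0 < eps ^+ 2 / 4 by rewrite divr_gt0 ?exprn_gt0.
  have [N _ hN] := near_infty_natSinv_lt (PosNum e2).
  exists N => k l Nk Nl; rewrite -(ltr_pXn2r (n := 2)) ?nnegrE ?hnorm_ge0 ?ltW//.
  apply: le_lt_trans (par _ _) _.
  have hk : k.+1%:R^-1 < eps ^+ 2 / 4 := hN k Nk.
  have hl : l.+1%:R^-1 < eps ^+ 2 / 4 := hN l Nl.
  have huk := hu k; have hul := hu l; move: (g (u k)) (g (u l)) huk hul => gk gl.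
  move: (k.+1%:R^-1) (l.+1%:R^-1) hk hl => ik il; lra.
set z := limn u in uc.
(* By continuity of [g] the infimum is attained at the limit [z]. *)
have gz : g z <= m.
  have gc : (fun k => g (u k)) @ \oo --> g z.
    apply: cvgB; first by apply: cvgM; exact: cvg_hnorm.
    apply: cvgMr.
    have h1 : (fun k => C * hnorm (u k - z)) @ \oo --> (0 : R).
      by rewrite -[X in _ --> X](mulr0 C); apply: cvgMr; apply/cvg_hnormP.
    have h2 : (fun k => - (C * hnorm (u k - z))) @ \oo --> (0 : R).
      by rewrite -[X in _ --> X]oppr0; apply: cvgN.
    rewrite -[X in _ --> X]add0r.
    rewrite (_ : (fun k => r (u k)) = (fun k => r (u k - z) + r z)); last first.
      by apply/funext => k; rewrite -rD subrK.
    apply: cvgD; last exact: cvg_cst.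
    by apply: squeeze_cvgr h2 h1; apply: nearW => k; rewrite -ler_norml.
  have mc : (fun k : nat => m + k.+1%:R^-1) @ \oo --> m.
    rewrite -[X in _ --> X]addr0; apply: cvgD; first exact: cvg_cst.
    exact: cvg_harmonic.
  apply: ler_cvg_to gc mc _; apply: nearW => k; exact: ltW.
(* First variation: moving [z] by [- (b s) h] changes [g] by [b^2 s (s ||h||^2 - 2)]. The choice of
   [s] keeps [s ||h||^2 <= 1], also for [h = 0], so minimality forces [b = 0]. *)
have re h : r h = rinner h z.
  pose b := rinner h z - r h; pose N2 := hnorm h ^+ 2.
  have N20 : 0 <= N2 by exact: sqr_ge0.
  pose s := (N2 + 1)^-1.
  have s0 : 0 < s by rewrite invr_gt0; lra.
  have sN : s * N2 <= 1 by rewrite /s mulrC ler_pdivrMr; lra.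
  have := mle (z + (- (b * s))%:C%C *: h).
  rewrite /g rD rZ hnorm_sqD hnormZR rinnerZr exprMn real_normK ?num_real//.
  rewrite -/N2 (rinnerC z h) => h1.
  have h2 : 0 <= (b * s) ^+ 2 * N2 - 2 * (b * s) * b.
    rewrite -(lerD2l (g z)) addr0; apply: le_trans gz _.
    by apply: le_trans h1 _; rewrite /g /b; lra.
  have h3 : (b * s) ^+ 2 * N2 - 2 * (b * s) * b = b ^+ 2 * s * (s * N2 - 2) by ring.
  have h4 : b ^+ 2 * s * (2 - s * N2) <= 0.
    by rewrite -oppr_ge0 -mulrN opprB -h3.
  have h5 : b ^+ 2 * s <= 0.
    have h6 : 0 <= b ^+ 2 * s by rewrite mulr_ge0 ?sqr_ge0 ?ltW.
    nra.
  rewrite pmulr_lle0// in h5.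
  have /eqP : b ^+ 2 = 0 by apply/eqP; rewrite eq_le h5 sqr_ge0.
  by rewrite sqrf_eq0 subr_eq0 => /eqP.
exists z => x.
have Im_i (w : R[i]) : complex.Im w = - complex.Re ('i%C * w).
  by case: w => a b /=; ring.
apply/eqP; rewrite eq_complex; apply/andP; split; apply/eqP; first exact: re.
by rewrite !Im_i -fZ -innerZl; congr (- _); exact: re.
Qed.

End Riesz.

(** * Bounded linear maps and their adjoints *)

Section Blin.
Context {R : realType}.
Implicit Types H K L : hilbertType R.

(** A predicate on bare functions, so that sums, composites and adjoints need no packing; [blin_bop]
    and [bop_of_blin] relate it to [bop]. *)
Record blin H K (f : H -> K) : Prop := Blin {
  blin_linear : linear f;
  blin_bounded : exists2 C : R, 0 <= C & forall x, hnorm (f x) <= C * hnorm x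
}.

Lemma blin0 H K (f : H -> K) : blin f -> f 0 = 0.
Proof.
by move=> [fl _]; have := fl (-1) 0 0; rewrite scaler0 addr0 scaleN1r addNr.
Qed.
Lemma blinD H K (f : H -> K) x y : blin f -> f (x + y) = f x + f y.
Proof. by move=> [fl _]; have := fl 1 x y; rewrite !scale1r. Qed.
Lemma blinZ H K (f : H -> K) c x : blin f -> f (c *: x) = c *: f x.
Proof. by move=> bf; have := blin_linear bf c x 0; rewrite !addr0 (blin0 bf) addr0. Qed.
Lemma blinB H K (f : H -> K) x y : blin f -> f (x - y) = f x - f y.
Proof. by move=> bf; rewrite blinD// -scaleN1r blinZ// scaleN1r. Qed.
Lemma blin_sum H K (f : H -> K) I (r : seq I) (E : I -> H) :
  blin f -> f (\sum_(i <- r) E i) = \sum_(i <- r) f (E i).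
Proof.
move=> bf; elim: r => [|i r ih]; first by rewrite !big_nil blin0.
by rewrite !big_cons blinD// ih.
Qed.

Lemma blin_bop H K (T : bop H K) : blin T.
Proof.
split; first exact: linearP.
have := @continuous_linear_bounded _ _ _ 0 T (@bop_continuous _ _ _ T 0).
move=> /linear_boundedP [M [Mr hM]].
(* The bound is available only for constants strictly above [M], and [C] must be a nonnegative
   real. *)
pose C := Num.max 0 (complex.Re M) + 1.
have C0 : 0 <= C by rewrite addr_ge0// le_max lexx.
exists C => // x.
have MC : M < C%:C%C.
  by rewrite -[M]RRe_real// ltcR /C ltr_pwDr// le_max lexx orbT.
by have := hM _ MC x; rewrite !normE -rmorphM lecR.
Qed.

Lemma bop_of_blin H K (f : H -> K) : blin f -> exists T : bop H K, T =1 f.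
Proof.
move=> bf; have [fl [C C0 hC]] := bf.
pose fm := GRing.isLinear.Build _ _ _ _ f fl.
pose F : {linear H -> K} := HB.pack f fm.
suff Fc : continuous F by exists (Bop Fc).
apply: bounded_linear_continuous; apply/linear_boundedP.
exists C%:C%C; split; first by rewrite complex_real.
move=> r Cr x.
have hx : `|f x| <= C%:C%C * `|x| by rewrite !normE -rmorphM lecR; exact: hC.
by apply: le_trans hx _; rewrite ler_wpM2r// ltW.
Qed.

Lemma blin_id H : blin (fun x : H => x).
Proof. by split=> [//|]; exists 1 => // x; rewrite mul1r. Qed.

Lemma blin_comp H K L (f : H -> K) (g : K -> L) :
  blin f -> blin g -> blin (fun x => g (f x)).
Proof.
move=> bf bg; have [fl [C C0 hC]] := bf; have [gl [D D0 hD]] := bg.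
split=> [a u v|]; first by rewrite fl gl.
exists (D * C) => [|x]; first exact: mulr_ge0.
by apply: le_trans (hD _) _; rewrite -mulrA ler_wpM2l.
Qed.

Lemma blinS H K (f : H -> K) c : blin f -> blin (fun x => c *: f x).
Proof.
move=> [fl [C C0 hC]]; split=> [a u v|].
  by rewrite fl scalerDr !scalerA mulrC.
exists (cnorm c * C) => [|x]; first by rewrite mulr_ge0 ?cnorm_ge0.
by rewrite hnormZ -mulrA ler_wpM2l ?cnorm_ge0.
Qed.

Lemma blin_fsum H K I (r : seq I) (f : I -> H -> K) :
  (forall i, blin (f i)) -> blin (fun x => \sum_(i <- r) f i x).
Proof.
move=> bf; elim: r => [|i r [sl [C C0 hC]]].
  split=> [a u v|]; first by rewrite !big_nil scaler0 addr0.
  by exists 0 => // x; rewrite big_nil hnorm0 mul0r.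
have [fl [D D0 hD]] := bf i.
split=> [a u v|].
  by rewrite !big_cons fl sl scalerDr addrACA.
exists (D + C) => [|x]; first exact: addr_ge0.
rewrite big_cons mulrDl.
apply: le_trans (hnorm_triangle _ _) _.
by rewrite lerD.
Qed.

Lemma blin_cvg H K (f : H -> K) (u : nat -> H) l :
  blin f -> u @ \oo --> l -> (fun k => f (u k)) @ \oo --> f l.
Proof.
move=> bf /cvg_hnormP h; have [_ [C C0 hC]] := bf.
apply/cvg_hnormP.
have h1 : (fun k => C * hnorm (u k - l)) @ \oo --> (0 : R).
  by rewrite -[X in _ --> X](mulr0 C); apply: cvgMr.
have h2 : (fun k : nat => (0 : R)) @ \oo --> (0 : R) by exact: cvg_cst.
apply: squeeze_cvgr h2 h1; apply: nearW => k.
by rewrite hnorm_ge0 -blinB// hC.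
Qed.

(** Riesz applied to [x |-> <f x, y>] shows that the set in [adjoint] is inhabited, so the default
    value of [xget] is not taken. *)
Lemma adjointE H K (f : H -> K) x y :
  blin f -> inner (f x) y = inner x (adjoint f y).
Proof.
move=> bf; have [fl [C C0 hC]] := bf.
suff [z hz] : exists z, forall x, inner (f x) y = inner x z.
  rewrite /adjoint; case: xgetP => [z' _ -> //|].
  by move=> /(_ z) /=.
apply: (@riesz _ _ _ (C * hnorm y)) => [a u v|u].
  by rewrite fl innerDl innerZl.
apply: le_trans (cnorm_inner _ _) _.
by rewrite mulrAC ler_wpM2r ?hnorm_ge0.
Qed.

Lemma adjoint_bound H K (f : H -> K) (C : R) y : blin f -> 0 <= C ->
  (forall x, hnorm (f x) <= C * hnorm x) ->
  hnorm (adjoint f y) <= C * hnorm y.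
Proof.
move=> bf C0 hC; apply: hnorm_le_test => [|x]; first by rewrite mulr_ge0 ?hnorm_ge0.
rewrite rinnerC /rinner -adjointE//; apply: le_trans (rinner_le _ _) _.
by rewrite mulrAC ler_wpM2r ?hnorm_ge0.
Qed.

(** Converse of [adjoint_bound], obtained by testing [f x] against all [y], without passing to the
    double adjoint. *)
Lemma bound_adjoint H K (f : H -> K) (C : R) x : blin f -> 0 <= C ->
  (forall y, hnorm (adjoint f y) <= C * hnorm y) ->
  hnorm (f x) <= C * hnorm x.
Proof.
move=> bf C0 hC; apply: hnorm_le_test => [|y]; first by rewrite mulr_ge0 ?hnorm_ge0.
rewrite /rinner adjointE//; apply: le_trans (rinner_le _ _) _.
by rewrite (mulrC C) -mulrA ler_wpM2l ?hnorm_ge0.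
Qed.

Lemma adjoint_blin H K (f : H -> K) : blin f -> blin (adjoint f).
Proof.
move=> bf; have [_ [C C0 hC]] := bf; split.
  move=> a u v; apply: inner_ext => x.
  by rewrite -adjointE// !innerDr !innerZr -!adjointE.
by exists C => // y; exact: adjoint_bound.
Qed.

Lemma opnorm_bound H K (f : H -> K) x :
  blin f -> hnorm (f x) <= opnorm f * hnorm x.
Proof.
move=> bf; have [_ [C C0 hC]] := bf.
have [x0|x0] := eqVneq (hnorm x) 0.
  by rewrite (hnorm_eq0 x0) blin0// !hnorm0 mulr0.
have xp : 0 < hnorm x by rewrite lt_neqAle eq_sym x0 hnorm_ge0.
rewrite -ler_pdivrMr//.
have -> : hnorm (f x) / hnorm x = hnorm (f ((hnorm x)^-1%:C%C *: x)).
  by rewrite blinZ// hnormZR ger0_norm ?invr_ge0 ?hnorm_ge0// mulrC.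
apply: ub_le_sup.
  exists C => _ /= [y y1 <-]; apply: le_trans (hC _) _.
  by rewrite -[leRHS]mulr1 ler_wpM2l.
exists ((hnorm x)^-1%:C%C *: x) => //=.
by rewrite hnormZR ger0_norm ?invr_ge0 ?hnorm_ge0// mulVf.
Qed.

Lemma opnorm_le H K (f : H -> K) (C : R) : 0 <= C ->
  (forall x, hnorm (f x) <= C * hnorm x) -> opnorm f <= C.
Proof.
move=> C0 hC; apply: ge_sup.
  by exists (hnorm (f 0)), 0 => //=; rewrite hnorm0.
move=> _ /= [y y1 <-]; apply: le_trans (hC _) _.
by rewrite -[leRHS]mulr1 ler_wpM2l.
Qed.

Lemma opnorm_ge0 H K (f : H -> K) : blin f -> 0 <= opnorm f.
Proof.
move=> bf; have [_ [C C0 hC]] := bf.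
apply: ub_le_sup.
  exists C => _ /= [y y1 <-]; apply: le_trans (hC _) _.
  by rewrite -[leRHS]mulr1 ler_wpM2l.
by exists 0; rewrite /= ?hnorm0// blin0// hnorm0.
Qed.

End Blin.

(** * Orthonormal bases and diagonal operators *)

Lemma cnorm_sq (R : realType) (c : R[i]) : c * Num.conj c = (cnorm c ^+ 2)%:C%C.
Proof. by rewrite -normCK cnormE rmorphXn. Qed.

Lemma cnormMR (R : realType) (r : R) (c : R[i]) : cnorm (r%:C%C * c) = `|r| * cnorm c.
Proof.
apply: complexI; rewrite rmorphM/= -!cnormE normrM; congr (_ * _).
by rewrite normc_def/= expr0n addr0 sqrtr_sqr.
Qed.

Lemma cvg_fsum (K : numFieldType) (V : pseudoMetricNormedZmodType K) J (r : seq J)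
    (u : J -> nat -> V) (l : J -> V) :
  (forall j, u j N @[N --> \oo] --> l j) ->
  (\sum_(j <- r) u j N) @[N --> \oo] --> \sum_(j <- r) l j.
Proof.
move=> h; elim: r => [|j r ih].
  by rewrite big_nil; under eq_fun do rewrite big_nil; exact: cvg_cst.
rewrite big_cons; under eq_fun do rewrite big_cons.
by apply: cvgD; [exact: h|exact: ih].
Qed.

Section Orthonormal.
Context {R : realType} {H : hilbertType R} {I : eqType} (e : I -> H).
Hypothesis oe : forall a b, inner (e a) (e b) = (a == b)%:R.

Lemma inner_comb (s : seq I) (u : I -> R[i]) b : uniq s ->
  inner (\sum_(a <- s) u a *: e a) (e b) = if b \in s then u b else 0.
Proof.
elim: s => [|a s ih]/=; first by rewrite big_nil inner0l.
move=> /andP[ns us]; rewrite big_cons innerDl innerZl oe ih// in_cons.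
have [<-|ab] := eqVneq a b; first by rewrite (negbTE ns) mulr1 addr0.
by rewrite mulr0 add0r.
Qed.

Lemma hnorm_comb (s : seq I) (u : I -> R[i]) : uniq s ->
  hnorm (\sum_(a <- s) u a *: e a) ^+ 2 = \sum_(a <- s) cnorm (u a) ^+ 2.
Proof.
move=> us; apply: complexI; rewrite -innerE inner_sumr rmorph_sum/=.
apply: eq_big_seq => a sa.
by rewrite innerZr inner_comb// sa mulrC cnorm_sq.
Qed.

(** Bessel's inequality: for the partial Fourier sum [p], [<x, p> = ||p||^2], hence
    [||x - p||^2 = ||x||^2 - ||p||^2]. *)
Lemma bessel (s : seq I) x : uniq s ->
  \sum_(a <- s) cnorm (inner x (e a)) ^+ 2 <= hnorm x ^+ 2.
Proof.
move=> us; pose p := \sum_(a <- s) inner x (e a) *: e a.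
have hp := hnorm_comb (fun a => inner x (e a)) us; rewrite -/p in hp.
have xp : rinner x p = hnorm p ^+ 2.
  rewrite /rinner hp inner_sumr; apply: complexI; rewrite -[RHS]addr0.
  rewrite (_ : \sum_(a <- s) inner x (inner x (e a) *: e a) =
    (\sum_(a <- s) cnorm (inner x (e a)) ^+ 2)%:C%C) ?addr0//.
  rewrite rmorph_sum; apply: eq_bigr => a _.
  by rewrite innerZr mulrC cnorm_sq.
by have := sqr_ge0 (hnorm (x - p)); rewrite hnorm_sqB xp -hp; lra.
Qed.

End Orthonormal.

(** * Expansions in a countable orthonormal basis and diagonal operators *)

Section Basis.
Context {R : realType} {H : hilbertType R} {I : countType} (e : I -> H).
Hypothesis He : orthonormal_basis e.
Let oe : forall a b, inner (e a) (e b) = (a == b)%:R := He.1.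

(** The indices with code below [N] form finite sets exhausting [I]; [pmap] skips the numbers that
    code no index. *)
Definition initial (N : nat) : seq I := pmap pickle_inv (iota 0 N).

Lemma initial_uniq N : uniq (initial N).
Proof. exact: (pmap_uniq (@pickle_invK I) (iota_uniq 0 N)). Qed.

Lemma mem_initial N a : (a \in initial N) = (choice.pickle a < N)%N.
Proof.
rewrite mem_pmap; apply/mapP/idP => [[k]|h].
  rewrite mem_iota add0n => /andP[_ kN] ha.
  by have := pickle_invK (T := I) k; rewrite -ha /= => ->.
by exists (choice.pickle a); rewrite ?mem_iota// pickleK_inv.
Qed.

(** Finite section of the diagonal operator with entries [c]; for bounded [c] that operator is the
    strong limit of its sections. *)
Definition diag_trunc (c : I -> R) N (x : H) : H :=
  \sum_(a <- initial N) ((c a)%:C%C * inner x (e a)) *: e a.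

Lemma diag_truncP c N : linear (diag_trunc c N).
Proof.
move=> k u v; rewrite /diag_trunc scaler_sumr -big_split/=; apply: eq_bigr => a _.
by rewrite innerDl innerZl mulrDr scalerDl scalerA mulrCA.
Qed.

Lemma hnorm_diag_trunc c M N x : 0 <= M -> (forall a, `|c a| <= M) ->
  hnorm (diag_trunc c N x) <= M * hnorm x.
Proof.
move=> M0 cM; rewrite -(ler_pXn2r (n := 2)) ?nnegrE ?mulr_ge0 ?hnorm_ge0//.
rewrite hnorm_comb ?initial_uniq// exprMn.
apply: le_trans (_ : M ^+ 2 * \sum_(a <- initial N) cnorm (inner x (e a)) ^+ 2
  <= _); last first.
  by rewrite ler_wpM2l ?sqr_ge0 ?bessel ?initial_uniq.
rewrite mulr_sumr; apply: ler_sum => a _.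
by rewrite cnormMR exprMn ler_wpM2r ?sqr_ge0// lerXn2r ?nnegrE.
Qed.

Lemma diag_trunc_basis c N a : (choice.pickle a < N)%N ->
  diag_trunc c N (e a) = (c a)%:C%C *: e a.
Proof.
move=> aN; rewrite /diag_trunc (bigD1_seq a) ?mem_initial ?initial_uniq//=.
rewrite oe eqxx mulr1 big1 ?addr0// => b ba.
by rewrite oe eq_sym (negbTE ba) mulr0 scale0r.
Qed.

Definition proj N (x : H) : H := \sum_(a <- initial N) inner x (e a) *: e a.

Lemma projE : proj = diag_trunc (fun=> 1).
Proof.
apply/funext => N; apply/funext => x; apply: eq_bigr => a _.
by rewrite rmorph1 mul1r.
Qed.

Lemma hnorm_proj N x : hnorm (proj N x) <= hnorm x.
Proof.
by rewrite projE -[leRHS]mul1r; apply: hnorm_diag_trunc => // a; rewrite normr1.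
Qed.

Lemma diag_trunc_span c (s : seq I) (u : I -> R[i]) :
  exists N0, forall N, (N0 <= N)%N ->
    diag_trunc c N (\sum_(a <- s) u a *: e a) =
    \sum_(a <- s) u a *: ((c a)%:C%C *: e a).
Proof.
elim: s => [|a s [N0 ih]].
  exists 0%N => N _; rewrite !big_nil.
  by have := diag_truncP c N (-1) 0 0; rewrite scaler0 addr0 scaleN1r addNr.
exists (maxn N0 (choice.pickle a).+1) => N; rewrite geq_max => /andP[N0N aN].
by rewrite !big_cons diag_truncP ih// diag_trunc_basis.
Qed.

Lemma span_approx x (eps : R) : 0 < eps ->
  exists (s : seq I) (u : I -> R[i]), hnorm (x - \sum_(a <- s) u a *: e a) < eps.
Proof.
move=> e0; have e0' : 0 < eps%:C%C :> R[i] by rewrite ltcR.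
have [|z [+ [s [u zE]]]] := He.2 (ball x eps%:C%C) _ (ball_open x _).
  by exists x; exact: ballxx.
by rewrite -ball_normE /ball_/= normE ltcR zE => h; exists s, u.
Qed.

Lemma diag_truncB c N x y : diag_trunc c N (x - y) = diag_trunc c N x - diag_trunc c N y.
Proof. by rewrite -[x - y]addrC -scaleN1r diag_truncP scaleN1r addrC. Qed.

(** The sections are uniformly bounded and eventually constant on finite combinations of basis
    vectors, which are dense; hence they are Cauchy at every [x]. *)
Lemma cvg_diag_trunc c M x : 0 <= M -> (forall a, `|c a| <= M) ->
  cvgn (fun N => diag_trunc c N x).
Proof.
move=> M0 cM; apply: hnorm_cauchy_cvg => eps e0.
(* Two errors of size at most [M ||x - z||] must add up to less than [eps]; [M + 1] avoids a zero
   denominator. *)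
have e1 : 0 < eps / (2 * (M + 1)) by rewrite divr_gt0// mulr_gt0//; lra.
have [s [u]] := span_approx x e1; set z := \sum_(a <- s) _ => xz.
have [N0 hN0] := diag_trunc_span c s u.
exists N0 => k l Nk Nl; have zz := hN0 k Nk; rewrite -(hN0 l Nl) -/z in zz.
have -> : diag_trunc c k x - diag_trunc c l x =
    diag_trunc c k (x - z) + - diag_trunc c l (x - z).
  by rewrite !diag_truncB zz opprB addrA subrK.
apply: le_lt_trans (hnorm_triangle _ _) _; rewrite hnorm_oppr.
have h1 := hnorm_diag_trunc k (x - z) M0 cM.
have h2 := hnorm_diag_trunc l (x - z) M0 cM.
have h3 : M * hnorm (x - z) <= (M + 1) * hnorm (x - z).
  by rewrite ler_wpM2r ?hnorm_ge0//; lra.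
have h4 : (M + 1) * hnorm (x - z) < eps / 2.
  have M1 : 0 < M + 1 by lra.
  rewrite mulrC -ltr_pdivlMr//; apply: lt_le_trans xz _.
  by rewrite invfM mulrA.
lra.
Qed.

Lemma proj_cvg x : proj N x @[N --> \oo] --> x.
Proof.
apply/cvg_hnormP/cvgrPdist_lt => eps e0.
have e1 : 0 < eps / 2 by lra.
have [s [u]] := span_approx x e1; set z := \sum_(a <- s) _ => xz.
have [N0 hN0] := diag_trunc_span (fun=> 1) s u.
exists N0 => // N /= N0N.
have zz : proj N z = z.
  rewrite projE hN0//; apply: eq_bigr => a _; by rewrite rmorph1 scale1r.
rewrite sub0r normrN ger0_norm ?hnorm_ge0//.
have -> : proj N x - x = proj N (x - z) + - (x - z).
  by rewrite projE diag_truncB -projE zz opprB addrA subrK.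
apply: le_lt_trans (hnorm_triangle _ _) _; rewrite hnorm_oppr.
have := hnorm_proj N (x - z); lra.
Qed.

Lemma blin_ext (K : hilbertType R) (f g : H -> K) : blin f -> blin g ->
  (forall a, f (e a) = g (e a)) -> f =1 g.
Proof.
move=> bf bg fg x.
have h1 := blin_cvg bf (@proj_cvg x); have h2 := blin_cvg bg (@proj_cvg x).
have fgN : (fun k => f (proj k x)) = (fun k => g (proj k x)).
  apply/funext => N; rewrite /proj !blin_sum//; apply: eq_bigr => a _.
  by rewrite !blinZ// fg.
by rewrite -(cvg_lim (@norm_hausdorff _ _) h1) fgN; exact: cvg_lim h2.
Qed.

Lemma basis_total x : (forall a, inner (e a) x = 0) -> x = 0.
Proof.
move=> h; rewrite -(cvg_lim (@norm_hausdorff _ _) (@proj_cvg x)).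
rewrite (_ : (fun N => proj N x) = fun=> 0); first by apply: lim_cst.
apply/funext => N; rewrite /proj big1// => a _.
by rewrite innerC h conjC0 scale0r.
Qed.

Lemma inner_basis_ext (K : hilbertType R) (f : H -> K) y : blin f ->
  (forall a, inner (f (e a)) y = 0) -> forall x, inner (f x) y = 0.
Proof.
move=> bf h x; rewrite adjointE// (_ : adjoint f y = 0) ?inner0r//.
by apply: basis_total => a; rewrite -adjointE.
Qed.

Lemma diagonal_exists (c : I -> R) (M : R) : (forall a, `|c a| <= M) ->
  exists D : bop H H, forall a, D (e a) = (c a)%:C%C *: e a.
Proof.
(* Over an empty index type the hypothesis does not exclude a negative [M]. *)
move=> cM'; pose M' := Num.max 0 M.
have M0 : 0 <= M' by rewrite le_max lexx.
have cM a : `|c a| <= M' by rewrite le_max cM' orbT.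
have cv x := @cvg_diag_trunc c M' x M0 cM.
pose d x : H := limn (fun N => diag_trunc c N x).
suff [bD De] : blin d /\ (forall a, d (e a) = (c a)%:C%C *: e a).
  by have [D hD] := bop_of_blin bD; exists D => a; rewrite hD.
split; last first.
  move=> a; apply: cvg_lim => //; apply: cvg_near_cst.
  by exists (choice.pickle a).+1 => // N /= aN; exact: diag_trunc_basis.
split.
  move=> k u v; apply: cvg_lim => //.
  rewrite (_ : (fun N => diag_trunc c N (k *: u + v)) =
    fun N => k *: diag_trunc c N u + diag_trunc c N v); last first.
    by apply/funext => N; rewrite diag_truncP.
  by apply: cvgD; [apply: cvgZr; exact: cv|exact: cv].
exists M' => // x.
apply: ler_cvg_to (cvg_hnorm (cv x)) (cvg_cst _) _.
by apply: nearW => N; exact: hnorm_diag_trunc.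
Qed.

(** Norm estimate for a column of weighted partial isometries: Pythagoras on [proj N x], exchange of
    the two sums, Bessel, then the limit in [N]. A target family [g] other than [e] covers shifts as
    well as diagonals. *)
Lemma weighted_family_bound (K : hilbertType R) (g : I -> K) J (r : seq J)
    (f : J -> H -> K) (c : J -> I -> R) (M : R) (x : H) :
  (forall a b, inner (g a) (g b) = (a == b)%:R) ->
  (forall j, blin (f j)) ->
  (forall j a, f j (e a) = (c j a)%:C%C *: g a) ->
  (forall a, \sum_(j <- r) c j a ^+ 2 <= M ^+ 2) ->
  \sum_(j <- r) hnorm (f j x) ^+ 2 <= M ^+ 2 * hnorm x ^+ 2.
Proof.
move=> og bf fe cM.
have cv : (\sum_(j <- r) hnorm (f j (proj N x)) ^+ 2) @[N --> \oo] -->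
    \sum_(j <- r) hnorm (f j x) ^+ 2.
  apply: cvg_fsum => j; apply: cvgM;
    by apply: cvg_hnorm; apply: blin_cvg => //; exact: proj_cvg.
apply: ler_cvg_to cv (cvg_cst _) _; apply: nearW => N.
apply: le_trans (_ : M ^+ 2 * \sum_(a <- initial N) cnorm (inner x (e a)) ^+ 2
  <= _); last first.
  by rewrite ler_wpM2l ?sqr_ge0 ?bessel ?initial_uniq.
rewrite (eq_bigr (fun j => \sum_(a <- initial N)
    c j a ^+ 2 * cnorm (inner x (e a)) ^+ 2)); last first.
  move=> j _; rewrite /proj blin_sum//.
  rewrite (eq_bigr (fun a => ((c j a)%:C%C * inner x (e a)) *: g a)); last first.
    by move=> a _; rewrite blinZ// fe scalerA mulrC.
  rewrite hnorm_comb ?initial_uniq//; apply: eq_bigr => a _.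
  by rewrite cnormMR exprMn real_normK ?num_real.
rewrite exchange_big/= mulr_sumr; apply: ler_sum => a _.
by rewrite -mulr_suml ler_wpM2r ?sqr_ge0.
Qed.

Lemma weighted_bound (K : hilbertType R) (g : I -> K)
    (f : H -> K) (c : I -> R) (M : R) (x : H) :
  (forall a b, inner (g a) (g b) = (a == b)%:R) -> blin f ->
  (forall a, f (e a) = (c a)%:C%C *: g a) ->
  0 <= M -> (forall a, `|c a| <= M) -> hnorm (f x) <= M * hnorm x.
Proof.
move=> og bf fe M0 cM.
rewrite -(ler_pXn2r (n := 2)) ?nnegrE ?mulr_ge0 ?hnorm_ge0// exprMn.
have := @weighted_family_bound K g unit [:: tt] (fun=> f) (fun=> c) M x og
  (fun=> bf) (fun=> fe); rewrite big_seq1; apply => a.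
by rewrite big_seq1 -[c a ^+ 2]real_normK ?num_real// lerXn2r ?nnegrE.
Qed.

End Basis.

(** * Row operators and multishifts *)

Section RowOperators.
Context {R : realType} {H : hilbertType R} {J : finType} (f : J -> H -> H).
Hypothesis bf : forall j, blin (f j).

(** The operator [G G^*] for the row [G] with entries [f j]. *)
Definition row_square x := \sum_j f j (adjoint (f j) x).

Lemma row_square_blin : blin row_square.
Proof.
apply: blin_fsum => j; apply: (blin_comp (adjoint_blin (bf j)) (bf j)).
Qed.

Lemma inner_row_square x :
  inner (row_square x) x = (\sum_j hnorm (adjoint (f j) x) ^+ 2)%:C%C.
Proof.
rewrite inner_suml rmorph_sum; apply: eq_bigr => j _.
by rewrite adjointE// innerE.
Qed.

Lemma rinner_row_square x :
  rinner (row_square x) x = \sum_j hnorm (adjoint (f j) x) ^+ 2.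
Proof. by rewrite /rinner inner_row_square. Qed.

(** The quadratic form of [row_square] dominates [||adjoint (f j) y||^2], and a bound on the adjoint
    passes back to [f j]. *)
Lemma row_square_entry j (C : R) x : 0 <= C ->
  (forall y, rinner (row_square y) y <= C ^+ 2 * hnorm y ^+ 2) ->
  hnorm (f j x) <= C * hnorm x.
Proof.
move=> C0 hC; apply: bound_adjoint => // y.
rewrite -(ler_pXn2r (n := 2)) ?nnegrE ?mulr_ge0 ?hnorm_ge0// exprMn.
apply: le_trans (hC y); rewrite rinner_row_square (bigD1 j)//= lerDl.
by apply: sumr_ge0 => i _; exact: sqr_ge0.
Qed.

(** The summands of [S] are orthogonal, so [||S||^2] is at most [M^2] times the sum of the
    [||adjoint (f j) x||^2]. That sum is [Re <S, x>], at most [||S|| ||x||]; cancel [||S||]. *)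
Lemma row_square_bound (M : R) x : 0 <= M ->
  (forall j x, hnorm (f j x) <= M * hnorm x) ->
  (forall i j x y, i != j -> inner (f i x) (f j y) = 0) ->
  hnorm (row_square x) <= M ^+ 2 * hnorm x.
Proof.
move=> M0 fM orth; pose S := row_square x.
have S2 : hnorm S ^+ 2 = \sum_j hnorm (f j (adjoint (f j) x)) ^+ 2.
  apply: complexI; rewrite -innerE {1}/S inner_suml rmorph_sum.
  apply: eq_bigr => i _; rewrite inner_sumr (bigD1 i)//= innerE big1 ?addr0// => j ji.
  by rewrite orth// eq_sym.
have h1 : hnorm S ^+ 2 <= M ^+ 2 * (hnorm S * hnorm x).
  apply: le_trans (_ : M ^+ 2 * rinner S x <= _); last first.
    by rewrite ler_wpM2l ?sqr_ge0 ?rinner_le.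
  rewrite S2 rinner_row_square mulr_sumr; apply: ler_sum => j _.
  by rewrite -exprMn lerXn2r ?nnegrE ?mulr_ge0 ?hnorm_ge0.
have [S0|S0] := eqVneq (hnorm S) 0.
  by rewrite -/S S0 mulr_ge0 ?sqr_ge0 ?hnorm_ge0.
have Sp : 0 < hnorm S by rewrite lt_neqAle eq_sym S0 hnorm_ge0.
by rewrite -/S -(ler_pM2l Sp) -expr2 mulrCA.
Qed.

End RowOperators.

(** * Words in an operator tuple and weighted multishifts *)

Section Words.
Context {R : realType} {n : nat}.
Implicit Types (H K : hilbertType R) (mu : seq 'I_n -> R).

Lemma opword_blin H (T : 'I_n -> bop H H) a : blin (opword T a).
Proof.
elim: a => [|i a ih]; first exact: blin_id.
exact: (blin_comp ih (blin_bop (T i))).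
Qed.

Lemma nceval_blin H (T : 'I_n -> bop H H) (p : ncpoly R n) : blin (nceval T p).
Proof. by apply: blin_fsum => m; apply: blinS; exact: opword_blin. Qed.

Lemma opword_similar H K (T : 'I_n -> bop H H) (T' : 'I_n -> bop K K) A B a x :
  implements_similarity T T' A B -> opword T a x = B (opword T' a (A x)).
Proof.
move=> [AK BK TE]; elim: a => [|i a ih]/=; first by rewrite AK.
by rewrite TE ih BK.
Qed.

Lemma opword_contraction H (T : 'I_n -> bop H H) a x :
  (forall i x, hnorm (T i x) <= hnorm x) -> hnorm (opword T a x) <= hnorm x.
Proof. by move=> hT; elim: a => //= i a ih; apply: le_trans (hT _ _) ih. Qed.

Lemma row_contraction_entry H (T : 'I_n -> bop H H) i x :
  row_contraction T -> hnorm (T i x) <= hnorm x.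
Proof.
move=> rT; rewrite -[leRHS]mul1r.
apply: (@row_square_entry _ _ _ (fun i => T i)) => //.
  by move=> j; exact: blin_bop.
move=> y; have := rT y; rewrite expr1n mul1r -rinnerE.
by rewrite lecE => /andP[].
Qed.

Lemma weight_boundP mu (M : R) :
  weight_bound mu M <-> forall b a, weight_prod mu b a <= M.
Proof.
split=> [h b a|h k].
  rewrite -lee_fin; apply: le_trans (h (size b)); apply: ereal_sup_ubound.
  by exists (a, b).
by apply: ge_ereal_sup => _ /= [[a b] _ <-]; rewrite lee_fin.
Qed.

Lemma weight_prod_ge0 mu b a : (forall b, b != [::] -> 0 <= mu b) ->
  0 <= weight_prod mu b a.
Proof. by move=> mu0; elim: b => //= i b ih; rewrite mulr_ge0// mu0. Qed.

(** [weight_prod] recurses on the first letter of [b]; comparing suprema at [a] and at [i :: a]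
    requires peeling off the last one. *)
Lemma weight_prod_rcons mu b i a :
  weight_prod mu (rcons b i) a = weight_prod mu b (i :: a) * mu (i :: a).
Proof.
by elim: b => [|j b ih] /=; rewrite ?mulr1 ?mul1r// ih mulrA -cats1 -catA.
Qed.

Section Multishift.
Context {F : hilbertType R} (e : seq 'I_n -> F).
Hypothesis He : orthonormal_basis e.

Section Shift.
Variables (mu : seq 'I_n -> R) (W : 'I_n -> bop F F).
Hypothesis HW : weighted_multishift e mu W.

Lemma opword_basis b a : opword W b (e a) = (weight_prod mu b a)%:C%C *: e (b ++ a).
Proof.
elim: b => [|i b ih] /=; first by rewrite rmorph1 scale1r.
by rewrite ih linearZ/= HW scalerA -rmorphM mulrC.
Qed.

Lemma weight_prod_le_opword (C : R) b a :
  (forall x, hnorm (opword W b x) <= C * hnorm x) -> weight_prod mu b a <= C.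
Proof.
move=> /(_ (e a)).
have e1 c : hnorm (e c) = 1.
  apply/eqP; rewrite -(pexpr_eq1 (n := 2)) ?hnorm_ge0//.
  by rewrite -rinnerE /rinner He.1 eqxx.
by rewrite opword_basis hnormZR !e1 !mulr1; apply: le_trans; exact: ler_norm.
Qed.

(** The words [b ++ a] and [c ++ d] differ because their prefixes of equal length do; totality of
    the basis extends this from basis vectors, one argument at a time. *)
Lemma opword_orthogonal b c x y : size b = size c -> b != c ->
  inner (opword W b x) (opword W c y) = 0.
Proof.
move=> sbc bc; apply: (inner_basis_ext He (opword_blin W b)) => a.
rewrite innerC; suff -> : inner (opword W c y) (opword W b (e a)) = 0 by rewrite conjC0.
apply: (inner_basis_ext He (opword_blin W c)) => d.
rewrite !opword_basis innerZl innerZr He.1 eqseq_cat//.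
by rewrite eq_sym (negbTE bc) !mulr0.
Qed.

Lemma opword_bound (M : R) b x : 0 <= M ->
  (forall a, `|weight_prod mu b a| <= M) -> hnorm (opword W b x) <= M * hnorm x.
Proof.
move=> M0 hM; apply: (weighted_bound He (g := fun a => e (b ++ a))) => //.
- by move=> a c; rewrite He.1 eqseq_cat// eqxx.
- exact: opword_blin.
- by move=> a; exact: opword_basis.
Qed.

Lemma word_sum_blin k : blin (word_sum W k).
Proof.
exact: (@row_square_blin _ _ _ (fun a : k.-tuple 'I_n => opword W a)
  (fun a => opword_blin W a)).
Qed.

Lemma word_sum_bound (M : R) k x : 0 <= M ->
  (forall b a, `|weight_prod mu b a| <= M) ->
  hnorm (word_sum W k x) <= M ^+ 2 * hnorm x.
Proof.
move=> M0 hM.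
apply: (@row_square_bound _ _ _ (fun a : k.-tuple 'I_n => opword W a)) => //.
- by move=> a; exact: opword_blin.
- by move=> a y; exact: opword_bound.
- by move=> a b y z ab; apply: opword_orthogonal; rewrite ?size_tuple.
Qed.

(** A word shorter than [k] has no prefix of length [k], so [e a] is orthogonal to the range of each
    [opword W b] in the sum. *)
Lemma word_sum_basis k a : (size a < k)%N -> word_sum W k (e a) = 0.
Proof.
move=> ak; rewrite /word_sum big1// => b _.
rewrite (_ : adjoint _ _ = 0) ?(blin0 (opword_blin W b))//.
apply: (basis_total He) => c; rewrite -adjointE; last exact: opword_blin.
rewrite opword_basis innerZl He.1; case: eqP => [h|]; last by rewrite mulr0.
by move: ak; rewrite -h size_cat size_tuple ltnNge leq_addr.
Qed.

Lemma multishift_row_contraction :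
  (forall i a, `|mu (i :: a)| <= 1) -> row_contraction W.
Proof.
move=> mu1 x.
have bW i : blin (W i) by exact: blin_bop.
have -> : \sum_(i < n) W i (adjoint (W i) x) = row_square (fun i => W i) x by [].
rewrite inner_row_square// innerE lecR -rinner_row_square//.
apply: le_trans (rinner_le _ _) _; rewrite expr2 ler_wpM2r ?hnorm_ge0//.
rewrite -[leRHS]mul1r -[X in X * _](expr1n _ 2).
apply: row_square_bound => // [i y|i j y z ij].
  apply: (opword_bound (b := [:: i])) => // a.
  by rewrite /= mulr1.
by apply: (opword_orthogonal (b := [:: i]) (c := [:: j])) => //; rewrite eqseq_cons andbT.
Qed.

Lemma multishift_pure :
  (forall b a, `|weight_prod mu b a| <= 1) -> pure W.
Proof.
move=> mu1 x; apply/cvg_hnormP/cvgrPdist_lt => eps e0.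
have [s [u]] := span_approx He x e0; set z := \sum_(a <- s) _ => xz.
(* Beyond this threshold [word_sum W k] kills the approximant [z], and it contracts the remainder
   [x - z]. *)
exists (\max_(a <- s) (size a).+1)%N => // k /= hk.
have wz : word_sum W k z = 0.
  rewrite blin_sum; last exact: word_sum_blin.
  rewrite big_seq big1// => a sa; rewrite blinZ; last exact: word_sum_blin.
  rewrite word_sum_basis ?scaler0//; apply: leq_trans hk.
  exact: (leq_bigmax_seq (F := fun a : seq 'I_n => (size a).+1) a sa).
rewrite sub0r normrN ger0_norm ?hnorm_ge0// subr0.
rewrite -[x](subrK z) blinD ?wz ?addr0; last exact: word_sum_blin.
apply: le_lt_trans xz; rewrite -[leRHS]mul1r -[X in X * _](expr1n _ 2).
exact: word_sum_bound.
Qed.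

End Shift.
End Multishift.
End Words.

(** * Normalized weights and operator matrices *)

Section Normalization.
Context {R : realType} {n : nat} (mu : seq 'I_n -> R) (M : R).
Hypotheses (mu0 : forall b, b != [::] -> 0 <= mu b)
           (muM : forall b a, weight_prod mu b a <= M).

(** For nonnegative weights this is the largest norm in the forward orbit of [e a], namely the
    supremum of [||W_b e_a||]. *)
Definition forward_sup a : R := sup [set weight_prod mu b a | b in setT].
Local Notation d := forward_sup.

Lemma forward_sup_ub b a : weight_prod mu b a <= d a.
Proof. by apply: ub_le_sup; [exists M => _ [c _ <-]; exact: muM|exists b]. Qed.

Lemma forward_sup_ge1 a : 1 <= d a.
Proof. exact: (forward_sup_ub [::] a). Qed.

Lemma forward_sup_gt0 a : 0 < d a.
Proof. exact: lt_le_trans (forward_sup_ge1 a). Qed.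

Lemma forward_sup_le a : d a <= M.
Proof.
by apply: ge_sup; [exists (weight_prod mu [::] a), [::]|move=> _ [b _ <-]; exact: muM].
Qed.

(** A product starting at [i :: a], times [mu (i :: a)], is the product for [rcons b i] starting at
    [a]. A zero weight is set aside because the argument divides by it. *)
Lemma forward_sup_cons i a : d (i :: a) * mu (i :: a) <= d a.
Proof.
have [m0|m0] := eqVneq (mu (i :: a)) 0.
  by rewrite m0 mulr0 ltW ?forward_sup_gt0.
have mp : 0 < mu (i :: a) by rewrite lt_neqAle eq_sym m0 mu0.
rewrite -ler_pdivlMr//; apply: ge_sup.
  by exists (weight_prod mu [::] (i :: a)), [::].
move=> _ [b _ <-]; rewrite ler_pdivlMr// -weight_prod_rcons.
exact: forward_sup_ub.
Qed.

(* The value at the empty word is never used. *)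
Definition normalized_weight b : R := mu b * d b / d (behead b).
Local Notation nu := normalized_weight.

Lemma normalized_weight_ge0 i a : 0 <= nu (i :: a).
Proof. by rewrite !mulr_ge0 ?invr_ge0 ?mu0 ?ltW ?forward_sup_gt0. Qed.

Lemma normalized_weight_le1 i a : nu (i :: a) <= 1.
Proof.
by rewrite /nu/= ler_pdivrMr ?forward_sup_gt0// mul1r mulrC forward_sup_cons.
Qed.

(** The ratios of consecutive values of [d] telescope along the word. *)
Lemma weight_prod_normalized b a :
  weight_prod nu b a = weight_prod mu b a * d (b ++ a) / d a.
Proof.
elim: b => [|i b ih] /=; first by rewrite mul1r divff// gt_eqF ?forward_sup_gt0.
rewrite ih /nu/=; have := forward_sup_gt0 (b ++ a); have := forward_sup_gt0 a.
by move=> /lt0r_neq0 h1 /lt0r_neq0 h2; field; rewrite h1 h2.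
Qed.

Lemma weight_prod_normalized_le1 b a : `|weight_prod nu b a| <= 1.
Proof.
elim: b => [|i b ih] /=; first by rewrite normr1.
rewrite normrM mulr_ile1//.
by rewrite ger0_norm ?normalized_weight_ge0// normalized_weight_le1.
Qed.

(* <xi_{ba}, xi_a> = nu(b, a) with unit vectors xi_a of l^2: this exhibits p(W)
   as a bounded Schur multiple of p(S).  The vector xi_a has one coordinate for
   each suffix of a; the suffix of length j is where the backward walk along a,
   surviving each step with amplitude nu, is stopped. *)
Fixpoint schur_vec (a : seq 'I_n) (j : nat) : R :=
  if a is _ :: a' then
    if j == size a then Num.sqrt (1 - nu a ^+ 2) else nu a * schur_vec a' j
  else (j == 0%N)%:R.

Lemma schur_vec_oversize a j : (size a < j)%N -> schur_vec a j = 0.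
Proof.
elim: a => [|i a ih] /=; first by case: j.
by move=> h; rewrite gtn_eqF// ih ?mulr0// ltnW.
Qed.

(** Each letter splits the unit mass into [1 - nu^2] at a new coordinate and [nu^2] spread over the
    old ones. *)
Lemma sum_schur_vec_sq a J : (size a < J)%N -> \sum_(0 <= j < J) schur_vec a j ^+ 2 = 1.
Proof.
elim: a J => [|i a ih] J.
  case: J => // J _; rewrite big_nat_recl//= expr1n big1 ?addr0// => j _.
  by rewrite expr0n.
move=> h; have h' : (size a < J)%N := ltnW h.
rewrite (bigD1_seq (size a).+1) ?mem_index_iota ?iota_uniq//= eqxx.
rewrite sqr_sqrtr; last first.
  rewrite subr_ge0 expr_le1// ?normalized_weight_ge0//.
  exact: normalized_weight_le1.
rewrite (eq_bigr (fun j => nu (i :: a) ^+ 2 * schur_vec a j ^+ 2)); last first.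
  by move=> j /negbTE ->; rewrite exprMn.
rewrite -mulr_sumr; have := ih _ h'.
rewrite (bigD1_seq (size a).+1) ?mem_index_iota ?iota_uniq//=.
by rewrite schur_vec_oversize// expr0n add0r => ->; rewrite mulr1 subrK.
Qed.

Lemma sum_schur_vec_le1 a J : \sum_(0 <= j < J) schur_vec a j ^+ 2 <= 1.
Proof.
have h : (size a < maxn J (size a).+1)%N by rewrite leq_max ltnSn orbT.
rewrite -(sum_schur_vec_sq h) (big_cat_nat (n := J) _ (p := maxn _ _))//= ?leq_maxl//.
by rewrite lerDl; apply: sumr_ge0 => j _; exact: sqr_ge0.
Qed.

Lemma schur_vec_le1 a j : `|schur_vec a j| <= 1.
Proof.
rewrite -(ler_pXn2r (n := 2)) ?nnegrE// expr1n real_normK ?num_real//.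
apply: le_trans (sum_schur_vec_le1 a j.+1); rewrite big_nat_recr//= lerDr.
by apply: sumr_ge0 => i _; exact: sqr_ge0.
Qed.

(** A letter put in front of [b ++ a] scales the old coordinates by [nu] and opens a new one, at
    which [schur_vec a] vanishes. *)
Lemma inner_schur_vec b a J : (size a < J)%N ->
  \sum_(0 <= j < J) schur_vec (b ++ a) j * schur_vec a j = weight_prod nu b a.
Proof.
move=> aJ; elim: b => [|i b ih] /=.
  by rewrite -(sum_schur_vec_sq aJ); apply: eq_bigr => j _; rewrite expr2.
rewrite -ih mulr_sumr; apply: eq_bigr => j _; case: ifPn => [/eqP ->|_].
  by rewrite schur_vec_oversize ?mulr0// size_cat ltnS leq_addl.
by rewrite mulrA.
Qed.

End Normalization.

(** * Norms of operator matrices *)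

Section OperatorMatrix.
Context {R : realType} {H : hilbertType R} {k : nat}.
Variable A : 'I_k -> 'I_k -> H -> H.
Hypothesis bA : forall s q, blin (A s q).

(** A crude bound from the norms of the entries, making the [sup] in [opmx_norm] a genuine
    supremum. *)
Let opmx_bounded : has_ubound
  [set Num.sqrt (\sum_(s < k) hnorm (\sum_(q < k) A s q (x q)) ^+ 2)
      | x in [set x : 'I_k -> H | \sum_(q < k) hnorm (x q) ^+ 2 <= 1]].
Proof.
have [C hC] : {C : 'I_k * 'I_k -> R & forall sq,
    0 <= C sq /\ forall x, hnorm (A sq.1 sq.2 x) <= C sq * hnorm x}.
  apply: (@boolp.choice _ _ (fun sq c => 0 <= c /\
    forall x, hnorm (A sq.1 sq.2 x) <= c * hnorm x)) => sq.
  by have [_ [C C0 h]] := bA sq.1 sq.2; exists C.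
exists (Num.sqrt (\sum_(s < k) (\sum_(q < k) C (s, q)) ^+ 2)) => _ /= [x x1 <-].
rewrite ler_wsqrtr//; apply: ler_sum => s _.
have C0 : 0 <= \sum_(q < k) C (s, q) by apply: sumr_ge0 => q _; exact: (hC _).1.
rewrite lerXn2r ?nnegrE ?hnorm_ge0//.
apply: le_trans (hnorm_sum _ _) _; apply: ler_sum => q _.
apply: le_trans ((hC (s, q)).2 _) _; rewrite -[leRHS]mulr1.
rewrite ler_wpM2l ?(hC _).1//.
rewrite -(ler_pXn2r (n := 2)) ?nnegrE ?hnorm_ge0// expr1n.
apply: le_trans x1; rewrite (bigD1 q)//= lerDl.
by apply: sumr_ge0 => j _; exact: sqr_ge0.
Qed.

Lemma opmx_norm_ge0 : 0 <= opmx_norm A.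
Proof.
apply: le_trans (sqrtr_ge0 (\sum_(s < k) hnorm (\sum_(q < k) A s q 0) ^+ 2)) _.
apply: (ub_le_sup opmx_bounded); exists (fun=> 0) => //=.
by rewrite big1// => q _; rewrite hnorm0 expr0n.
Qed.

Lemma opmx_norm_bound (x : 'I_k -> H) :
  \sum_(s < k) hnorm (\sum_(q < k) A s q (x q)) ^+ 2 <=
  opmx_norm A ^+ 2 * \sum_(q < k) hnorm (x q) ^+ 2.
Proof.
set N2 := \sum_(q < k) hnorm (x q) ^+ 2.
have N20 : 0 <= N2 by apply: sumr_ge0 => q _; exact: sqr_ge0.
have [N0|N0] := eqVneq N2 0.
  rewrite N0 mulr0 big1// => s _; rewrite big1 ?hnorm0 ?expr0n// => q _.
  move/eqP: N0; rewrite psumr_eq0; last by move=> j _; exact: sqr_ge0.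
  move=> /allP /(_ q (mem_index_enum q)); rewrite sqrf_eq0 => /eqP/hnorm_eq0 ->.
  exact: blin0.
have Np : 0 < N2 by rewrite lt_neqAle eq_sym N0.
pose r := (Num.sqrt N2)^-1.
have r2 : r ^+ 2 = N2^-1 by rewrite exprVn sqr_sqrtr.
have rZ y : hnorm (r%:C%C *: y) ^+ 2 = N2^-1 * hnorm y ^+ 2.
  by rewrite hnormZR exprMn real_normK ?num_real// r2.
set S := (X in X <= _).
have S0 : 0 <= S by apply: sumr_ge0 => s _; exact: sqr_ge0.
rewrite -ler_pdivrMr// mulrC.
have : Num.sqrt (N2^-1 * S) <= opmx_norm A.
  apply: (ub_le_sup opmx_bounded); exists (fun q => r%:C%C *: x q) => /=.
    rewrite (eq_bigr (fun q => N2^-1 * hnorm (x q) ^+ 2)) => [|q _]; last exact: rZ.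
    by rewrite -mulr_sumr mulVf.
  congr Num.sqrt; rewrite mulr_sumr; apply: eq_bigr => s _.
  rewrite -rZ scaler_sumr; congr (hnorm _ ^+ 2).
  by apply: eq_bigr => q _; rewrite blinZ.
move=> h; rewrite -(ler_pXn2r (n := 2)) ?nnegrE ?sqrtr_ge0 ?opmx_norm_ge0// in h.
by rewrite sqr_sqrtr ?mulr_ge0 ?invr_ge0 in h.
Qed.

Lemma opmx_norm_le (C : R) : 0 <= C ->
  (forall x : 'I_k -> H, \sum_(s < k) hnorm (\sum_(q < k) A s q (x q)) ^+ 2 <=
    C ^+ 2 * \sum_(q < k) hnorm (x q) ^+ 2) ->
  opmx_norm A <= C.
Proof.
move=> C0 hC; apply: ge_sup.
  by eexists; exists (fun=> 0) => //=; rewrite big1// => q _; rewrite hnorm0 expr0n.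
move=> _ /= [x x1 <-].
rewrite -[leRHS]ger0_norm// -sqrtr_sqr ler_wsqrtr//.
apply: le_trans (hC x) _; rewrite -[leRHS]mulr1.
by rewrite ler_wpM2l ?sqr_ge0.
Qed.

End OperatorMatrix.

Lemma opmx_norm1 (R : realType) (H : hilbertType R) (f : H -> H) : blin f ->
  opmx_norm (fun _ _ : 'I_1 => f) = opnorm f.
Proof.
move=> bf; apply/eqP; rewrite eq_le; apply/andP; split.
  apply: opmx_norm_le (opnorm_ge0 bf) _ => x.
  by rewrite !big_ord1 -exprMn lerXn2r ?nnegrE ?hnorm_ge0 ?opnorm_bound//
    mulr_ge0 ?hnorm_ge0 ?opnorm_ge0.
have bA : forall s q : 'I_1, blin ((fun _ _ : 'I_1 => f) s q) by [].
apply: opnorm_le (opmx_norm_ge0 bA) _ => x.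
have := opmx_norm_bound bA (fun=> x); rewrite !big_ord1 -exprMn.
by rewrite ler_pXn2r// nnegrE ?mulr_ge0 ?hnorm_ge0 ?opmx_norm_ge0.
Qed.

(** * Schur multiplication *)

(** Diagonal operators with real entries are self-adjoint: [D - c a] sends each basis vector into
    the orthogonal complement of [e a]. *)
Lemma inner_diagonal (R : realType) (H : hilbertType R) (I : countType)
    (e : I -> H) (D : bop H H) (c : I -> R) a g :
  orthonormal_basis e -> (forall a, D (e a) = (c a)%:C%C *: e a) ->
  inner (e a) (D g) = (c a)%:C%C * inner (e a) g.
Proof.
move=> He hD.
pose f x := D x + (- (c a))%:C%C *: x.
have bf : blin f.
  (* Written as a sum over the booleans, [f] falls under [blin_fsum]. *)
  have -> : f = fun x => \sum_(b <- [:: true; false])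
      (if b then D x else (- (c a))%:C%C *: x).
    by apply/funext => x; rewrite big_cons big_seq1.
  apply: blin_fsum => -[]; first exact: blin_bop.
  exact: (blinS _ (blin_id H)).
have : inner (f g) (e a) = 0.
  apply: (inner_basis_ext He bf) => b; rewrite /f hD -scalerDl -rmorphD innerZl He.1.
  by have [->|] := eqVneq b a; rewrite ?subrr ?mul0r ?mulr0.
rewrite /f innerDl innerZl rmorphN mulNr => /subr0_eq h.
rewrite innerC h rmorphM [in RHS]innerC; congr (_ * _); exact: conjc_real.
Qed.

Section Domination.
Context {R : realType} {n : nat} {F : hilbertType R} (e : seq 'I_n -> F).
Hypothesis He : orthonormal_basis e.
Variables (mu : seq 'I_n -> R) (M : R).
Hypotheses (mu0 : forall b, b != [::] -> 0 <= mu b)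
           (muM : forall b a, weight_prod mu b a <= M).
Variables (S W : 'I_n -> bop F F).
Hypotheses (HS : left_creation e S) (HW : weighted_multishift e mu W).
Local Notation d := (forward_sup mu).
Local Notation xi := (schur_vec mu).

Lemma left_creation_word b a : opword S b (e a) = e (b ++ a).
Proof. by elim: b => //= i b ->; exact: HS. Qed.

Lemma forward_bound : 1 <= M.
Proof. exact: le_trans (forward_sup_ge1 muM [::]) (forward_sup_le muM _). Qed.

Section Diagonals.
Variables (D D' : nat -> bop F F).
Hypotheses
  (hD : forall j a, D j (e a) = (d a * xi a j)%:C%C *: e a)
  (hD' : forall j a, D' j (e a) = (xi a j / d a)%:C%C *: e a).

(** Weak form of the Schur factorization on one word. With [D' j] moved to the left, the scalar is
    [d a / d (b ++ a)] times the inner product of the two Schur vectors, hence [mu(b, a)]; the bound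
    on [J] retains every coordinate of [xi a]. *)
Lemma schur_opword J b a g : (size a < J)%N ->
  \sum_(0 <= j < J) inner (opword S b (D j (e a))) (D' j g) =
  inner (opword W b (e a)) g.
Proof.
move=> aJ; rewrite (opword_basis HW) innerZl.
transitivity ((\sum_(0 <= j < J) d a * xi a j * (xi (b ++ a) j / d (b ++ a)))%:C%C
    * inner (e (b ++ a)) g).
  rewrite rmorph_sum mulr_suml; apply: eq_bigr => j _.
  rewrite hD blinZ; last exact: opword_blin.
  rewrite left_creation_word innerZl (inner_diagonal _ _ He (hD' j)).
  by rewrite mulrA -rmorphM.
congr (_%:C%C * _).
have d0 c : d c != 0 by rewrite gt_eqF ?(forward_sup_gt0 muM).
rewrite (eq_bigr (fun j => d a / d (b ++ a) * (xi (b ++ a) j * xi a j))); last first.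
  by move=> j _; field.
rewrite -mulr_sumr (inner_schur_vec mu0 muM)// (weight_prod_normalized muM).
by field; rewrite !d0.
Qed.

Lemma schur_nceval J (p : ncpoly R n) (s : seq (seq 'I_n)) (c : seq 'I_n -> R[i]) g :
  (forall a, a \in s -> (size a < J)%N) ->
  \sum_(0 <= j < J) inner (nceval S p (D j (\sum_(a <- s) c a *: e a))) (D' j g) =
  inner (nceval W p (\sum_(a <- s) c a *: e a)) g.
Proof.
move=> sJ; rewrite (blin_sum _ _ (nceval_blin W p)) inner_suml.
rewrite (eq_bigr (fun j => \sum_(a <- s) c a * \sum_(m <- msupp p)
    mcoeff m p * inner (opword S m (D j (e a))) (D' j g))); last first.
  move=> j _.
  rewrite (blin_sum _ _ (blin_comp (blin_bop (D j)) (nceval_blin S p))) inner_suml.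
  apply: eq_bigr => a _.
  rewrite (blinZ _ _ (blin_comp (blin_bop (D j)) (nceval_blin S p))) innerZl.
  by congr (_ * _); rewrite inner_suml; apply: eq_bigr => m _; rewrite innerZl.
rewrite exchange_big/= big_seq [RHS]big_seq; apply: eq_bigr => a sa.
rewrite (blinZ _ _ (nceval_blin W p)) innerZl -mulr_sumr; congr (_ * _).
rewrite exchange_big/= inner_suml; apply: eq_bigr => m _.
by rewrite -mulr_sumr schur_opword ?sJ// innerZl.
Qed.

End Diagonals.

(** On finite combinations only finitely many coordinates [j] enter. The output is paired with
    itself through the factorization, and [2 Re <u, v> <= ||u||^2 + ||v||^2] takes the place of
    Cauchy-Schwarz. *)
Lemma schur_domination_span k (p : 'I_k -> 'I_k -> ncpoly R n)
    (s : seq (seq 'I_n)) (c : 'I_k -> seq 'I_n -> R[i]) (x : 'I_k -> F) :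
  (forall q, x q = \sum_(a <- s) c q a *: e a) ->
  \sum_(t < k) hnorm (\sum_(q < k) nceval W (p t q) (x q)) ^+ 2 <=
  (M * opmx_norm (fun t q => nceval S (p t q))) ^+ 2 * \sum_(q < k) hnorm (x q) ^+ 2.
Proof.
move=> xE; set Ns := opmx_norm _.
have M1 := forward_bound.
have xi1 := schur_vec_le1 mu0 muM.
have [D hD] : {D : nat -> bop F F & forall j a, D j (e a) = (d a * xi a j)%:C%C *: e a}.
  apply: (@boolp.choice _ _ (fun j (D : bop F F) => forall a,
    D (e a) = (d a * xi a j)%:C%C *: e a)).
  move=> j; apply: (diagonal_exists He (M := M)) => a.
  rewrite normrM -[M]mulr1 ler_pM// ger0_norm ?(forward_sup_le muM)//.
  exact: ltW (forward_sup_gt0 muM a).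
have [D' hD'] : {D : nat -> bop F F & forall j a, D j (e a) = (xi a j / d a)%:C%C *: e a}.
  apply: (@boolp.choice _ _ (fun j (D : bop F F) => forall a,
    D (e a) = (xi a j / d a)%:C%C *: e a)).
  move=> j; apply: (diagonal_exists He (M := 1)) => a.
  rewrite normrM mulr_ile1// normfV invf_le1 ?normr_gt0 ?gt_eqF ?(forward_sup_gt0 muM)//.
  exact: le_trans (forward_sup_ge1 muM a) (ler_norm _).
pose J := (\max_(a <- s) (size a).+1)%N.
have sJ a : a \in s -> (size a < J)%N.
  by move=> sa; apply: (leq_bigmax_seq (F := fun a : seq 'I_n => (size a).+1) a sa).
pose out t := \sum_(q < k) nceval W (p t q) (x q).
pose u t j := \sum_(q < k) nceval S (p t q) (D j (x q)).
pose v t j := D' j (out t).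
have outE t : hnorm (out t) ^+ 2 = \sum_(0 <= j < J) rinner (u t j) (v t j).
  have h : \sum_(0 <= j < J) inner (u t j) (v t j) = (hnorm (out t) ^+ 2)%:C%C.
    rewrite -innerE [in RHS]/out inner_suml.
    rewrite (eq_bigr (fun j => \sum_(q < k) inner (nceval S (p t q) (D j (x q)))
      (D' j (out t)))); last by move=> j _; rewrite -inner_suml.
    rewrite exchange_big/=; apply: eq_bigr => q _.
    by rewrite xE (schur_nceval hD hD').
  by rewrite -raddf_sum h.
(* The matrix norm for [S] is applied for each [j]; then the sum over [j] of [(d a * xi a j)^2] is
   at most [d a ^ 2], hence at most [M^2]. *)
have uB : \sum_(t < k) \sum_(0 <= j < J) hnorm (u t j) ^+ 2 <=
    (M * Ns) ^+ 2 * \sum_(q < k) hnorm (x q) ^+ 2.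
  rewrite exchange_big/=.
  apply: le_trans (_ : \sum_(0 <= j < J) Ns ^+ 2 *
    \sum_(q < k) hnorm (D j (x q)) ^+ 2 <= _).
    by apply: ler_sum => j _; apply: opmx_norm_bound => t q; exact: nceval_blin.
  rewrite -mulr_sumr exchange_big/=.
  have -> X : (M * Ns) ^+ 2 * X = Ns ^+ 2 * (M ^+ 2 * X) by ring.
  apply: ler_wpM2l; first exact: sqr_ge0.
  rewrite mulr_sumr; apply: ler_sum => q _.
  apply: (weighted_family_bound He (g := e) (f := fun j => D j)
    (c := fun j a => d a * xi a j)) => //.
  - exact: He.1.
  - by move=> j; exact: blin_bop.
  move=> a; under eq_bigr do rewrite exprMn; rewrite -mulr_sumr -[leRHS]mulr1.
  rewrite ler_pM ?sqr_ge0 ?(sum_schur_vec_le1 mu0 muM)//.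
    by apply: sumr_ge0 => j _; exact: sqr_ge0.
  have d0 := ltW (forward_sup_gt0 muM a).
  by rewrite lerXn2r ?nnegrE ?(forward_sup_le muM)// (le_trans ler01).
(* Here the squared entries sum to at most [1 / d a ^ 2], and [1 <= d a]. *)
have vB : \sum_(t < k) \sum_(0 <= j < J) hnorm (v t j) ^+ 2 <=
    \sum_(t < k) hnorm (out t) ^+ 2.
  apply: ler_sum => t _; rewrite -[leRHS]mul1r -[X in X * _](expr1n _ 2).
  apply: (weighted_family_bound He (g := e) (f := fun j => D' j)
    (c := fun j a => xi a j / d a)) => //.
  - exact: He.1.
  - by move=> j; exact: blin_bop.
  move=> a; under eq_bigr do rewrite exprMn; rewrite -mulr_suml expr1n.
  rewrite mulr_ile1 ?sqr_ge0 ?(sum_schur_vec_le1 mu0 muM)//.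
    by apply: sumr_ge0 => j _; exact: sqr_ge0.
  have d0 := forward_sup_gt0 muM a.
  apply: exprn_ile1; first by rewrite invr_ge0 ltW.
  by rewrite invf_le1// (forward_sup_ge1 muM).
(* By [vB] one copy of the output is absorbed on the left, and [uB] bounds what is left. *)
have key : 2 * \sum_(t < k) hnorm (out t) ^+ 2 <=
    \sum_(t < k) \sum_(0 <= j < J) hnorm (u t j) ^+ 2 +
    \sum_(t < k) \sum_(0 <= j < J) hnorm (v t j) ^+ 2.
  rewrite -big_split/= mulr_sumr; apply: ler_sum => t _.
  rewrite -big_split/= outE mulr_sumr; apply: ler_sum => j _.
  by have := sqr_ge0 (hnorm (u t j - v t j)); rewrite hnorm_sqB; lra.
rewrite -/(out _); lra.
Qed.

(** The projections [proj e N (x q)] share one finite support and do not increase norms; apply the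
    finite case to them and let [N] grow. *)
Lemma schur_domination k (p : 'I_k -> 'I_k -> ncpoly R n) :
  opmx_norm (fun s q => nceval W (p s q)) <=
  M * opmx_norm (fun s q => nceval S (p s q)).
Proof.
have bS t q : blin (nceval S (p t q)) by exact: nceval_blin.
have C0 : 0 <= M * opmx_norm (fun s q => nceval S (p s q)).
  by rewrite mulr_ge0 ?opmx_norm_ge0// (le_trans ler01 forward_bound).
apply: opmx_norm_le => // x.
have cW : (\sum_(t < k) hnorm (\sum_(q < k) nceval W (p t q) (proj e N (x q))) ^+ 2)
    @[N --> \oo] --> \sum_(t < k) hnorm (\sum_(q < k) nceval W (p t q) (x q)) ^+ 2.
  apply: cvg_fsum => t.
  have h : hnorm (\sum_(q < k) nceval W (p t q) (proj e N (x q))) @[N --> \oo] -->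
      hnorm (\sum_(q < k) nceval W (p t q) (x q)).
    apply: cvg_hnorm; apply: cvg_fsum => q.
    by apply: blin_cvg; [exact: nceval_blin|exact: proj_cvg].
  by apply: cvgM.
apply: ler_cvg_to cW (cvg_cst _) _; apply: nearW => N.
apply: le_trans (schur_domination_span p (fun q => erefl (proj e N (x q)))) _.
rewrite ler_wpM2l ?sqr_ge0//; apply: ler_sum => q _.
by rewrite lerXn2r ?nnegrE ?hnorm_ge0// (hnorm_proj He).
Qed.

End Domination.

(** * The equivalences *)

Section Multishift.
Context {R : realType} {n : nat} {F : hilbertType R} (e : seq 'I_n -> F).
Hypothesis He : orthonormal_basis e.
Variables (mu : seq 'I_n -> R) (W : 'I_n -> bop F F).
Hypotheses (mu0 : forall b, b != [::] -> 0 <= mu b)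
           (HW : weighted_multishift e mu W).

Lemma similar_pure_row_contraction (M : R) : weight_bound mu M ->
  exists (K : hilbertType R) (T : 'I_n -> bop K K) (A : bop F K) (B : bop K F),
    [/\ row_contraction T, pure T, implements_similarity W T A B
      & opnorm A * opnorm B <= M].
Proof.
move=> /weight_boundP muM.
pose d := forward_sup mu; pose nu := normalized_weight mu.
have d1 a : 1 <= d a := forward_sup_ge1 muM a.
have d0 a : 0 < d a := forward_sup_gt0 muM a.
have M0 : 0 <= M := le_trans ler01 (forward_bound muM).
have dM a : `|d a| <= M by rewrite ger0_norm ?(ltW (d0 a))// (forward_sup_le muM).
have dV1 a : `|(d a)^-1| <= 1.
  by rewrite ger0_norm ?invr_ge0 ?(ltW (d0 a))// invf_le1.
(* [A] is the diagonal of [d], of norm at most [M], and [B] that of [1 / d], of norm at most 1; this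
   is the source of the constant [M]. *)
have [A hA] := diagonal_exists He dM.
have [B hB] := diagonal_exists He dV1.
have dd a : (d a)^-1%:C%C * (d a)%:C%C = 1 :> R[i].
  by rewrite -rmorphM mulVf ?rmorph1// gt_eqF.
have AK : cancel A B.
  apply: (blin_ext He (blin_comp (blin_bop A) (blin_bop B)) (blin_id F)) => a.
  by rewrite hA linearZ/= hB scalerA mulrC dd scale1r.
have BK : cancel B A.
  apply: (blin_ext He (blin_comp (blin_bop B) (blin_bop A)) (blin_id F)) => a.
  by rewrite hB linearZ/= hA scalerA dd scale1r.
have [T hT] : {T : 'I_n -> bop F F & forall i x, T i x = A (W i (B x))}.
  apply: (@boolp.choice _ _ (fun i (G : bop F F) => forall x, G x = A (W i (B x)))).
  move=> i; apply: bop_of_blin.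
  exact: (blin_comp (blin_comp (blin_bop B) (blin_bop (W i))) (blin_bop A)).
have Tnu : weighted_multishift e nu T.
  move=> i a; rewrite hT hB linearZ/= HW !linearZ/= hA !scalerA -!rmorphM.
  congr (_ *: _); congr (_%:C%C); rewrite /nu /normalized_weight/= -/d; ring.
exists F, T, A, B; split.
- apply: (multishift_row_contraction He Tnu) => i a.
  rewrite ger0_norm; first exact: (normalized_weight_le1 mu0 muM).
  exact: (normalized_weight_ge0 mu0 muM).
- by apply: (multishift_pure He Tnu) => b a; exact: (weight_prod_normalized_le1 mu0 muM).
- by split=> // i x; rewrite hT !AK.
rewrite -[leRHS]mulr1; apply: ler_pM.
- exact: opnorm_ge0 (blin_bop A).
- exact: opnorm_ge0 (blin_bop B).
- apply: opnorm_le => // x.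
  by apply: (weighted_bound He (g := e) (c := d)) => //; [exact: He.1|exact: blin_bop].
- apply: opnorm_le => // x.
  by apply: (weighted_bound He (g := e) (c := fun a => (d a)^-1)) => //;
    [exact: He.1|exact: blin_bop].
Qed.

(** [W_b = B T_b A], and [T_b] is a product of contractions; the added 1 only makes the constant
    positive. *)
Lemma similar_row_contraction_weight_bound (K : hilbertType R) (T : 'I_n -> bop K K) :
  row_contraction T -> jointly_similar W T ->
  exists2 M : R, 0 < M & weight_bound mu M.
Proof.
move=> rT [A [B sim]].
have [_ [CA CA0 hA]] := blin_bop A; have [_ [CB CB0 hB]] := blin_bop B.
exists (CB * CA + 1); first by rewrite ltr_wpDl ?mulr_ge0.
apply/weight_boundP => b a; apply: (weight_prod_le_opword He HW) => x.
rewrite (opword_similar _ _ sim); apply: le_trans (hB _) _.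
apply: le_trans (_ : CB * (CA * hnorm x) <= _).
  rewrite ler_wpM2l//; apply: le_trans (hA x); apply: opword_contraction => i y.
  exact: row_contraction_entry.
by rewrite mulrA ler_wpM2r ?hnorm_ge0// lerDl.
Qed.

Lemma row_power_bounded_weight_bound :
  row_power_bounded W -> exists2 M : R, 0 < M & weight_bound mu M.
Proof.
move=> [C C0 hC]; exists C => //; apply/weight_boundP => b a.
apply: (weight_prod_le_opword He HW) => x.
have bW (c : (size b).-tuple 'I_n) : blin (opword W c) by exact: opword_blin.
(* [W_b W_b^*] is one of the positive summands of [word_sum W (size b)], so the bound on the sum
   controls [W_b]. *)
apply: (row_square_entry bW (in_tuple b)); first exact: ltW.
move=> y; apply: le_trans (rinner_le _ _) _.
rewrite [hnorm y ^+ 2]expr2 mulrA ler_wpM2r ?hnorm_ge0//.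
have bS : blin (word_sum W (size b)) by exact: word_sum_blin.
apply: le_trans (opnorm_bound _ bS) _; rewrite ler_wpM2r ?hnorm_ge0//.
by rewrite -[leLHS]sqr_sqrtr ?opnorm_ge0// lerXn2r ?nnegrE ?sqrtr_ge0 ?hC// ltW.
Qed.

Lemma weight_bound_row_power_bounded (M : R) : 0 < M -> weight_bound mu M ->
  row_power_bounded W.
Proof.
move=> M0 /weight_boundP muM; exists M => // k.
rewrite -[leRHS]ger0_norm ?(ltW M0)// -sqrtr_sqr ler_wsqrtr//.
apply: opnorm_le => [|x]; first exact: sqr_ge0.
apply: (word_sum_bound He HW); first exact: ltW.
by move=> b a; rewrite ger0_norm ?weight_prod_ge0.
Qed.

Lemma nceval_monomial (T : 'I_n -> bop F F) b :
  nceval T (mkmalgU (FMonom b) 1 : ncpoly R n) = opword T b.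
Proof.
apply/funext => x; rewrite /nceval msuppU oner_eq0 big_seq_fset1.
by rewrite mcoeffUU scale1r.
Qed.

(** Test on the monomial of [b]: [S] is the multishift with all weights 1, so [S_b] is a contraction
    and [||W_b|| <= C]. *)
Lemma polynomially_bounded_weight_bound (S : 'I_n -> bop F F) :
  left_creation e S -> polynomially_bounded W S ->
  exists2 M : R, 0 < M & weight_bound mu M.
Proof.
move=> HS [C C0 hC]; exists C => //; apply/weight_boundP => b a.
apply: (weight_prod_le_opword He HW) => x.
apply: le_trans (opnorm_bound _ (opword_blin W b)) _.
rewrite ler_wpM2r ?hnorm_ge0//.
have := hC (mkmalgU (FMonom b) 1); rewrite !nceval_monomial => /le_trans; apply.
rewrite -[leRHS]mulr1 ler_wpM2l ?(ltW C0)//; apply: opnorm_le => // y.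
have S1 : weighted_multishift e (fun=> 1) S.
  by move=> i c; rewrite rmorph1 scale1r HS.
apply: (opword_bound He S1) => // c.
have -> : weight_prod (fun=> 1 : R) b c = 1 by elim: b => //= i b ->; rewrite mulr1.
by rewrite normr1.
Qed.

End Multishift.

Lemma completely_polynomially_bounded_polynomially_bounded (R : realType) (n : nat)
    (F : hilbertType R) (W S : 'I_n -> bop F F) :
  completely_polynomially_bounded W S -> polynomially_bounded W S.
Proof.
move=> [C C0 hC]; exists C => // p.
have := hC 1%N (fun _ _ => p).
by rewrite !opmx_norm1//; exact: nceval_blin.
Qed.

Theorem theorem1p12 (R : realType) (n : nat) (n_ge1 : (1 <= n)%N)
    (F : hilbertType R) (e : seq 'I_n -> F) (He : orthonormal_basis e)
    (S : 'I_n -> bop F F) (HS : left_creation e S)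
    (mu : seq 'I_n -> R) (Hmu : multishift_weights mu)
    (W : 'I_n -> bop F F) (HW : weighted_multishift e mu W) :
  [<-> row_power_bounded W;
       exists2 M : R, 0 < M & weight_bound mu M;
       exists (K : hilbertType R) (T : 'I_n -> bop K K),
         row_contraction T /\ jointly_similar W T;
       exists (K : hilbertType R) (T : 'I_n -> bop K K),
         [/\ row_contraction T, pure T & jointly_similar W T];
       completely_polynomially_bounded W S;
       polynomially_bounded W S]
  /\
  (forall M : R, 0 < M -> weight_bound mu M ->
     exists (K : hilbertType R) (T : 'I_n -> bop K K)
            (A : bop F K) (B : bop K F),
       [/\ row_contraction T, pure T, implements_similarity W T A B
         & opnorm A * opnorm B <= M]).
Proof.
have [mu0 _] := Hmu.
split; last by move=> M _; exact: (similar_pure_row_contraction He mu0 HW).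
tfae.
- exact: (row_power_bounded_weight_bound He HW).
- move=> [M _ /(similar_pure_row_contraction He mu0 HW)[K [T [A [B [rT _ sim _]]]]]].
  by exists K, T; split=> //; exists A, B.
(* The given [T] need not be pure; return to the weight bound and replace [T] by the normalized
   multishift. *)
- move=> [K [T [rT sT]]].
  have [M _] := similar_row_contraction_weight_bound He HW rT sT.
  move=> /(similar_pure_row_contraction He mu0 HW)[K' [T' [A [B [rT' pT' sim _]]]]].
  by exists K', T'; split=> //; exists A, B.
- move=> [K [T [rT _ sT]]].
  have [M M0 /weight_boundP muM] := similar_row_contraction_weight_bound He HW rT sT.
  exists M => // k p; exact: (schur_domination He mu0 muM HS HW).
- exact: completely_polynomially_bounded_polynomially_bounded.
(* The cycle closes through the weight bound. *)
- move=> /(polynomially_bounded_weight_bound He HW HS)[M M0].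
  exact: (weight_bound_row_power_bounded He mu0 HW M0).
Qed.
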